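(* Let $B$ be an almost polycyclic brace. Then $B$ is supersoluble if and only if every finite homomorphic image of $B$ is supersoluble.
   Context: A brace (skew left brace) is a set $B$ with two binary operations $+$ and $\cdot$ such that $(B,+)$ and $(B,\cdot)$ are groups and $a(b+c)=ab-a+ac$ for all $a,b,c\in B$. $\lambda_a(b)=-a+ab$ defines a homomorphism $\lambda\colon(B,\cdot)\to\operatorname{Aut}(B,+)$. A subbrace is a subset that is a subgroup of both groups; an ideal is a subbrace normal in both groups and invariant under all $\lambda_b$; quotients by ideals are braces; homomorphic images are quotients by ideals. $\operatorname{Soc}(B)=\operatorname{Ker}\lambda\cap Z(B,+)$. $B$ is supersoluble if there is a finite chain of ideals $\{0\}=I_0\le\dots\le I_n=B$ such that for each $i$, either $(I_{i+1}/I_i,+)$ is infinite cyclic and $I_{i+1}/I_i\le\operatorname{Soc}(B/I_i)$, or $I_{i+1}/I_i$ has prime order. $B$ is almost polycyclic if there is a finite chain of ideals $\{0\}=J_0\le\dots\le J_n=B$ such that for each $i$, either $J_{i+1}/J_i\le\operatorname{Soc}(B/J_i)$ and $J_{i+1}/J_i$ is finitely generated as a brace, or $J_{i+1}/J_i$ is finite. *)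

(* Defs.v *)
From mathcomp Require Import all_boot all_algebra.
Set Implicit Arguments. Unset Strict Implicit. Unset Printing Implicit Defensive.

Record brace := Brace {
  car :> Type;
  badd : car -> car -> car;
  bneg : car -> car;
  bzero : car;
  bmul : car -> car -> car;
  binv : car -> car;
  bone : car;
  baddA : forall a b c, badd a (badd b c) = badd (badd a b) c;
  badd0l : forall a, badd bzero a = a;
  baddNl : forall a, badd (bneg a) a = bzero;
  bmulA : forall a b c, bmul a (bmul b c) = bmul (bmul a b) c;
  bmul1l : forall a, bmul bone a = a;
  bmulVl : forall a, bmul (binv a) a = bone;
  bbrace : forall a b c, bmul a (badd b c) = badd (badd (bmul a b) (bneg a)) (bmul a c)
}.

Arguments bzero {b0} : rename. Arguments bone {b0} : rename.
Section BraceDefs.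
Variable B : brace.
Implicit Types (S I J K : B -> Prop) (a b x y : B).

Local Notation "x + y" := (badd x y).
Local Notation "- x" := (bneg x).
Local Notation "x * y" := (bmul x y).

Definition blam a b : B := - a + a * b.

Definition subgroup_add S := S (@bzero B) /\ (forall x y, S x -> S y -> S (x + y)) /\ (forall x, S x -> S (- x)).
Definition subgroup_mul S := S (@bone B) /\ (forall x y, S x -> S y -> S (x * y)) /\ (forall x, S x -> S (binv x)).
Definition subbrace S := subgroup_add S /\ subgroup_mul S.
Definition ideal S :=
  [/\ subbrace S,
      (forall a x, S x -> S (a + x + - a)),
      (forall a x, S x -> S (a * x * binv a)) &
      (forall a x, S x -> S (blam a x))].

Definition bfull : B -> Prop := fun _ => True.
Definition bzeroset : B -> Prop := fun x => x = @bzero B.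

Definition cong I x y := I (- x + y).

(* J/I <= Soc(B/I): for x in J, lambda_{x+I} = id on B/I and x+I is central in (B/I,+) *)
Definition soc_quot I J :=
  forall x, J x -> (forall b, cong I (blam x b) b) /\ (forall b, cong I (x + b) (b + x)).

Definition finite_quot I J :=
  exists (n : nat) (f : nat -> B), (forall i, i < n -> J (f i)) /\
    (forall x, J x -> exists2 i, i < n & cong I (f i) x).

Definition prime_order_quot I J :=
  exists (p : nat) (f : nat -> B), [/\ prime p,
    (forall i, i < p -> J (f i)),
    (forall i j, i < p -> j < p -> cong I (f i) (f j) -> i = j) &
    (forall x, J x -> exists2 i, i < p & cong I (f i) x)].

Fixpoint bmuln (g : B) (n : nat) : B := if n is n'.+1 then g + bmuln g n' else @bzero B.
Definition bmulz (g : B) (z : int) : B :=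
  match z with Posz n => bmuln g n | Negz n => - bmuln g n.+1 end.

Definition infcyclic_quot I J :=
  exists g, [/\ J g,
    (forall x, J x -> exists z : int, cong I (bmulz g z) x) &
    (forall n : nat, 0 < n -> ~ I (bmuln g n))].

Definition gen_subbrace S : B -> Prop :=
  fun x => forall K, subbrace K -> (forall y, S y -> K y) -> K x.

(* J/I is finitely generated as a brace (via the correspondence between
   subbraces of B/I and subbraces of B containing I) *)
Definition fg_quot I J :=
  exists (n : nat) (f : nat -> B), (forall i, i < n -> J (f i)) /\
    (forall x, J x <-> gen_subbrace (fun y => I y \/ exists2 i, i < n & y = f i) x).

Definition ideal_chain I (step : (B -> Prop) -> (B -> Prop) -> Prop) :=
  exists (n : nat) (c : nat -> B -> Prop),
    [/\ (forall x, c 0 x <-> I x),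
        (forall x, c n x),
        (forall i, i <= n -> ideal (c i)),
        (forall i x, i < n -> c i x -> c i.+1 x) &
        (forall i, i < n -> step (c i) (c i.+1))].

(* B/I is supersoluble (chains of ideals of B/I correspond to chains of
   ideals of B containing I, and (B/I)/(J/I) = B/J) *)
Definition supersoluble_quot I :=
  ideal_chain I (fun I J => (infcyclic_quot I J /\ soc_quot I J) \/ prime_order_quot I J).

Definition supersoluble := supersoluble_quot bzeroset.

Definition almost_polycyclic :=
  ideal_chain bzeroset (fun I J => (soc_quot I J /\ fg_quot I J) \/ finite_quot I J).

End BraceDefs.

(* Main.v *)
From HB Require Import structures.
Require Import Defs.
From mathcomp Require Import all_boot all_order all_algebra all_field.
From mathcomp Require Import boolp zify ring.
Set Implicit Arguments. Unset Strict Implicit. Unset Printing Implicit Defensive.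

(** If [F] is a finite ideal and [B / F] is supersoluble, then some ideal of finite
    index meets [F] trivially: [(B, +)] is finitely generated, so a multiple of a
    generator of an infinite cyclic factor lying above [F] acts trivially on [B].
    Hence finite ideals inherit chains with factors of prime order from the finite
    images of [B].

    For a finitely generated ideal [J] inside the socle, ideals of [B] inside [J]
    are the subgroups invariant under [lambda].  Torsion is again handled by finite
    ideals; if [J] is free of rank [r], the chains from [p J] to [J] show that the
    integer matrices of the action are simultaneously triangularizable modulo every
    prime [p].  A product of [r] Lie brackets of such matrices vanishes modulo every
    [p], so they commute on some nonzero invariant subspace; and their
    characteristic polynomials split modulo every [p].  This forces these
    polynomials to split over the integers, so that there is a common eigenvector,
    which spans an infinite cyclic ideal.

    The splitting criterion is proved without Chebotarev's theorem.  Let [f] be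
    irreducible of degree [n >= 2] with [n] roots modulo every [p], let [D] be its
    discriminant, [M = D ^ k] and [g(j) = M ^ n * f(j / M)].  By Hensel's lemma for
    the primes not dividing [D], and by the choice of [M] for the others, the
    product of the [g(j)] over the [L = 2 m + 1] integers [j] with [|j| <= m] is
    divisible by [L! ^ n] up to a factor [D ^ (n L / 2 ^ k)].  But this product is
    nonzero and at most about [m! ^ (2 n)], which is smaller by a factor of about
    [2 ^ (n L)]. *)

(** * Braces and their quotients *)

Declare Scope brace_scope.
Delimit Scope brace_scope with B.
Notation "x + y" := (badd x y) : brace_scope.
Notation "- x" := (bneg x) : brace_scope.
Notation "x * y" := (bmul x y) : brace_scope.
Notation "0" := (@bzero _) : brace_scope.
Bind Scope brace_scope with car.
Local Open Scope brace_scope.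

Section BraceTheory.
Variable B : brace.
Implicit Types (a b c x y z : B) (I J K : B -> Prop).

Lemma baddKl x y : - x + (x + y) = y.
Proof. by rewrite baddA baddNl badd0l. Qed.

Lemma baddI x y z : x + y = x + z -> y = z.
Proof. by move=> E; rewrite -(baddKl x y) E baddKl. Qed.

Lemma badd0r x : x + 0 = x.
Proof. by apply: (@baddI (- x)); rewrite baddA baddNl badd0l. Qed.

Lemma baddNr x : x + - x = 0.
Proof. by apply: (@baddI (- x)); rewrite baddKl badd0r. Qed.

Lemma baddNKl x y : x + (- x + y) = y.
Proof. by rewrite baddA baddNr badd0l. Qed.

Lemma baddK x y : x + y + - y = x.
Proof. by rewrite -baddA baddNr badd0r. Qed.

Lemma bneg_eq x y : x + y = 0 -> - x = y.
Proof. by move=> E; apply: (@baddI x); rewrite baddNr. Qed.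

Lemma bnegK x : - - x = x.
Proof. by apply: bneg_eq; rewrite baddNl. Qed.

Lemma bnegD x y : - (x + y) = - y + - x.
Proof. by apply: bneg_eq; rewrite baddA baddK baddNr. Qed.

Lemma bneg0 : - 0 = 0 :> B.
Proof. by apply: bneg_eq; rewrite badd0l. Qed.

Lemma bsub_eq x y : - x + y = 0 -> x = y.
Proof. by move=> E; rewrite -(badd0r x) -E baddNKl. Qed.

Lemma bmulKl x y : binv x * (x * y) = y.
Proof. by rewrite bmulA bmulVl bmul1l. Qed.

Lemma bmulI x y z : x * y = x * z -> y = z.
Proof. by move=> E; rewrite -(bmulKl x y) E bmulKl. Qed.

Lemma bmul1r x : x * bone = x.
Proof. by apply: (@bmulI (binv x)); rewrite bmulA bmulVl bmul1l. Qed.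

Lemma bmulVr x : x * binv x = bone.
Proof. by apply: (@bmulI (binv x)); rewrite bmulKl bmul1r. Qed.

Lemma bmulVKl x y : x * (binv x * y) = y.
Proof. by rewrite bmulA bmulVr bmul1l. Qed.

Lemma binv_eq x y : x * y = bone -> binv x = y.
Proof. by move=> E; apply: (@bmulI x); rewrite bmulVr. Qed.

Lemma binvK x : binv (binv x) = x.
Proof. by apply: binv_eq; rewrite bmulVl. Qed.

(** The brace identity with both summands zero reads [x * 0 = x * 0 + - x + x * 0]. Hence the two
    groups share their neutral element. *)
Lemma bmulx0 x : x * 0 = x.
Proof.
have := bbrace x 0 0; rewrite badd0l -baddA -{1}[x * 0]badd0r => /baddI/esym.
by rewrite -{2}(baddNl x) => /baddI.
Qed.

Lemma bone0 : bone = 0 :> B.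
Proof. by rewrite -[LHS]bmulx0 bmul1l. Qed.

Lemma bmul0x x : 0 * x = x.
Proof. by rewrite -bone0 bmul1l. Qed.

Lemma bmulE x y : x * y = x + blam x y.
Proof. by rewrite /blam baddNKl. Qed.

Lemma blamD x y z : blam x (y + z) = blam x y + blam x z.
Proof. by rewrite /blam bbrace !baddA. Qed.

Lemma blam0 x : blam x 0 = 0.
Proof. by rewrite /blam bmulx0 baddNl. Qed.

Lemma blam0l x : blam 0 x = x.
Proof. by rewrite /blam bmul0x bneg0 badd0l. Qed.

Lemma blamN x y : blam x (- y) = - blam x y.
Proof. by apply/esym/bneg_eq; rewrite -blamD baddNr blam0. Qed.

Lemma blamM x y z : blam (x * y) z = blam x (blam y z).
Proof.
rewrite {3}/blam blamD blamN {2 3}/blam bnegD bnegK.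
by rewrite -!baddA baddNKl bmulA.
Qed.

Lemma blamK x y : blam (binv x) (blam x y) = y.
Proof. by rewrite -blamM bmulVl bone0 blam0l. Qed.

Lemma blamVK x y : blam x (blam (binv x) y) = y.
Proof. by rewrite -blamM bmulVr bone0 blam0l. Qed.

Lemma blam_inj x y z : blam x y = blam x z -> y = z.
Proof. by move=> E; rewrite -(blamK x y) E blamK. Qed.

Lemma binvE x : binv x = blam (binv x) (- x).
Proof. by rewrite blamN /blam bmulVl bone0 badd0r bnegK. Qed.

Lemma set_ext (T : Type) (P Q : T -> Prop) : (forall t, P t <-> Q t) -> P = Q.
Proof. by move=> E; apply/funext => t; apply/propext. Qed.

Section Ideal.
Variable I : B -> Prop.
Hypothesis idI : ideal I.

Lemma ideal0 : I 0. Proof. by case: idI => -[[]]. Qed.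
Lemma idealD x y : I x -> I y -> I (x + y).
Proof. by case: idI => -[[_ []]] h *; apply: h. Qed.
Lemma idealN x : I x -> I (- x).
Proof. by case: idI => -[[_ [_]]] h *; apply: h. Qed.
Lemma idealM x y : I x -> I y -> I (x * y).
Proof. by case: idI => -[_ [_ []]] h *; apply: h. Qed.
Lemma idealV x : I x -> I (binv x).
Proof. by case: idI => -[_ [_ [_]]] h *; apply: h. Qed.
Lemma ideal_conj a x : I x -> I (a + x + - a).
Proof. by case: idI => _ h *; apply: h. Qed.
Lemma ideal_conjl a x : I x -> I (- a + x + a).
Proof. by move=> /(ideal_conj (- a)); rewrite bnegK. Qed.
Lemma ideal_mconj a x : I x -> I (a * x * binv a).
Proof. by case: idI => _ _ h *; apply: h. Qed.
Lemma ideal_blam a x : I x -> I (blam a x).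
Proof. by case: idI => _ _ _ h *; apply: h. Qed.

Lemma cong_refl x : cong I x x.
Proof. by rewrite /cong baddNl; apply: ideal0. Qed.

Lemma cong_sym x y : cong I x y -> cong I y x.
Proof. by move=> /idealN; rewrite /cong bnegD bnegK. Qed.

Lemma cong_trans x y z : cong I x y -> cong I y z -> cong I x z.
Proof. by move=> xy yz; have := idealD xy yz; rewrite /cong -baddA baddNKl. Qed.

Lemma congD x x' y y' : cong I x x' -> cong I y y' -> cong I (x + y) (x' + y').
Proof.
move=> xx' yy'; have := idealD (ideal_conjl y xx') yy'; rewrite /cong.
by rewrite bnegD -!baddA baddNKl.
Qed.

Lemma cong_mulr x y : I y -> cong I x (x * y).
Proof. by move=> Iy; rewrite /cong -/(blam x y); apply: ideal_blam. Qed.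

Lemma congM x x' y y' : cong I x x' -> cong I y y' -> cong I (x * y) (x' * y').
Proof.
move=> xx' yy'; apply: (@cong_trans _ (x * y')).
  have := ideal_blam x yy'; rewrite /cong blamD blamN {1 2}/blam bnegD bnegK.
  by rewrite -!baddA baddNKl.
(* This [j] in [I] satisfies [x' = x * j]; moving it to the right of [y'] turns it into a conjugate,
   which stays in [I]. *)
pose j := blam (binv x) (- x + x').
have Ij : I j by apply: ideal_blam.
have -> : x' = x * j by rewrite bmulE blamVK baddNKl.
have -> : x * j * y' = x * y' * (binv y' * j * binv (binv y')).
  by rewrite binvK -!bmulA bmulVKl.
by apply/cong_mulr/ideal_mconj.
Qed.

Lemma cong0 x : cong I 0 x = I x.
Proof. by rewrite /cong bneg0 badd0l. Qed.
Lemma congP x y : cong I x y -> exists2 i, I i & y = x + i.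
Proof. by exists (- x + y); rewrite ?baddNKl. Qed.
End Ideal.

Lemma bzeroset_ideal : ideal (@bzeroset B).
Proof.
rewrite /bzeroset; split; first split.
- by split=> //; split=> [x y -> ->|x ->]; rewrite ?badd0l ?bneg0.
- split; [exact: bone0 | split=> [x y -> ->|x ->]]; first by rewrite bmul0x.
  by apply: binv_eq; rewrite bmul0x bone0.
- by move=> a x ->; rewrite badd0r baddNr.
- by move=> a x ->; rewrite bmulx0 bmulVr bone0.
- by move=> a x ->; rewrite blam0.
Qed.

Lemma cong_bzeroset x y : cong (@bzeroset B) x y <-> x = y.
Proof. by split=> [/bsub_eq //|->]; rewrite /cong /bzeroset baddNl. Qed.

End BraceTheory.

Section Quotient.

(** The interface through which quotients are used: a surjective morphism whose fibres are the
    classes of [cong I]. *)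
Record quotient_map (B Q : brace) (I : B -> Prop) (f : B -> Q) : Prop := QuotientMap {
  qmD : forall x y, f (x + y) = f x + f y;
  qmM : forall x y, f (x * y) = f x * f y;
  qm_surj : forall q, exists x, f x = q;
  qm_eq : forall x y, f x = f y <-> cong I x y }.

Section Construction.
Variables (B : brace) (I : B -> Prop).
Hypothesis idI : ideal I.

(** A coset is the predicate [cong I x] itself, so that congruent elements give equal cosets by
    extensionality. *)
Definition coset_type := {S : B -> Prop | exists x, S = cong I x}.
Definition to_coset x : coset_type := exist _ (cong I x) (ex_intro _ x erefl).
Definition coset_rep (q : coset_type) : B := sval (cid (svalP q)).

Lemma to_cosetP x y : to_coset x = to_coset y <-> cong I x y.
Proof.
split=> [/(congr1 sval) /= E|xy].
  by rewrite E; apply: cong_refl.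
apply: eq_exist => /=; apply: set_ext => z.
by split; [apply/(cong_trans idI)/(cong_sym idI) | apply: (cong_trans idI)].
Qed.

Lemma coset_repK q : to_coset (coset_rep q) = q.
Proof.
by case: q => S SP; apply: eq_exist; rewrite /coset_rep /=; case: cid.
Qed.

Lemma coset_repP x : cong I (coset_rep (to_coset x)) x.
Proof. exact/to_cosetP/coset_repK. Qed.

Definition cadd p q := to_coset (coset_rep p + coset_rep q).
Definition cmul p q := to_coset (coset_rep p * coset_rep q).
Definition cneg q := to_coset (- coset_rep q).
Definition cinv q := to_coset (binv (coset_rep q)).

Lemma to_cosetD x y : to_coset (x + y) = cadd (to_coset x) (to_coset y).
Proof. by apply/to_cosetP/(congD idI); apply/(cong_sym idI)/coset_repP. Qed.
Lemma to_cosetM x y : to_coset (x * y) = cmul (to_coset x) (to_coset y).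
Proof. by apply/to_cosetP/(congM idI); apply/(cong_sym idI)/coset_repP. Qed.
Lemma cneg_rep q : cneg q = to_coset (- coset_rep q). Proof. by []. Qed.
Lemma cinv_rep q : cinv q = to_coset (binv (coset_rep q)). Proof. by []. Qed.

Let lift P : (forall x, P (to_coset x)) -> forall q, P q.
Proof. by move=> h q; rewrite -(coset_repK q). Qed.

Definition quotient_brace : brace.
Proof.
refine (@Brace coset_type cadd cneg (to_coset 0) cmul cinv (to_coset bone) _ _ _ _ _ _ _).
- elim/lift => x; elim/lift => y; elim/lift => z.
  by rewrite -!to_cosetD baddA.
- by elim/lift => x; rewrite -to_cosetD badd0l.
- by move=> q; rewrite -{2}(coset_repK q) cneg_rep -to_cosetD baddNl.
- elim/lift => x; elim/lift => y; elim/lift => z.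
  by rewrite -!to_cosetM bmulA.
- by elim/lift => x; rewrite -to_cosetM bmul1l.
- by move=> q; rewrite -{2}(coset_repK q) cinv_rep -to_cosetM bmulVl.
- move=> a; elim/lift => y; elim/lift => z.
  rewrite cneg_rep; have := coset_repK a; move: (coset_rep a) => r <-.
  by rewrite -to_cosetD -!to_cosetM -!to_cosetD bbrace.
Defined.

Lemma quotient_brace_map : @quotient_map B quotient_brace I to_coset.
Proof.
split; [exact: to_cosetD|exact: to_cosetM| |exact: to_cosetP].
by move=> q; exists (coset_rep q); apply: coset_repK.
Qed.
End Construction.

Lemma exists_quotient (B : brace) (I : B -> Prop) :
  ideal I -> exists (Q : brace) (f : B -> Q), quotient_map I f.
Proof.
by move=> idI; exists (quotient_brace idI), (to_coset I); apply: quotient_brace_map.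
Qed.
End Quotient.

Section QuotientTransport.
Variables (B Q : brace) (I : B -> Prop) (f : B -> Q).
Hypothesis fq : quotient_map I f.
Implicit Types (K L : Q -> Prop) (J : B -> Prop).

Definition preim K : B -> Prop := fun x => K (f x).
Definition image J : Q -> Prop := fun q => exists2 x, J x & f x = q.

Lemma qm0 : f 0 = 0.
Proof. by apply: (@baddI Q (f 0)); rewrite -(qmD fq) !badd0r. Qed.
Lemma qmN x : f (- x) = - f x.
Proof. by apply/esym/bneg_eq; rewrite -(qmD fq) baddNr qm0. Qed.
Lemma qmV x : f (binv x) = binv (f x).
Proof. by apply/esym/binv_eq; rewrite -(qmM fq) bmulVr !bone0 qm0. Qed.
Lemma qm_blam x y : f (blam x y) = blam (f x) (f y).
Proof. by rewrite /blam (qmD fq) qmN (qmM fq). Qed.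
Lemma qm_bmuln x n : f (bmuln x n) = bmuln (f x) n.
Proof. by elim: n => [|n IHn]; rewrite ?qm0 //= (qmD fq) IHn. Qed.
Lemma qm_bmulz x z : f (bmulz x z) = bmulz (f x) z.
Proof. by case: z => n; rewrite /bmulz ?qmN qm_bmuln. Qed.
Lemma qm_ker x : f x = 0 <-> I x.
Proof.
rewrite -(cong0 I) -(qm_eq fq) qm0; split=> /esym //.
Qed.

Lemma cong_preim K x y : cong (preim K) x y = cong K (f x) (f y).
Proof. by rewrite /cong /preim (qmD fq) qmN. Qed.

Lemma ideal_preim K : ideal K -> ideal (preim K).
Proof.
move=> idK; rewrite /preim; split; first split.
- split; first by rewrite qm0; apply: ideal0.
  split=> [x y Kx Ky|x Kx]; first by rewrite (qmD fq); apply: idealD.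
  by rewrite qmN; apply: idealN.
- split; first by rewrite bone0 qm0; apply: ideal0.
  split=> [x y Kx Ky|x Kx]; first by rewrite (qmM fq); apply: idealM.
  by rewrite qmV; apply: idealV.
- by move=> a x Kx; rewrite !(qmD fq) qmN; apply: ideal_conj.
- by move=> a x Kx; rewrite !(qmM fq) qmV; apply: ideal_mconj.
- by move=> a x Kx; rewrite qm_blam; apply: ideal_blam.
Qed.

Lemma ideal_image J : ideal J -> ideal (image J).
Proof.
move=> idJ; split; first split.
- split; first by exists 0; [apply: ideal0 | apply: qm0].
  split=> [_ _ [x Jx <-] [y Jy <-]|_ [x Jx <-]].
    by exists (x + y); [apply: idealD | apply: qmD fq _ _].
  by exists (- x); [apply: idealN | apply: qmN].
- split; first by rewrite bone0; exists 0; [apply: ideal0 | apply: qm0].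
  split=> [_ _ [x Jx <-] [y Jy <-]|_ [x Jx <-]].
    by exists (x * y); [apply: idealM | apply: qmM fq _ _].
  by exists (binv x); [apply: idealV | apply: qmV].
- move=> q _ [x Jx <-]; have [a <-] := qm_surj fq q.
  by exists (a + x + - a); [apply: ideal_conj | rewrite !(qmD fq) qmN].
- move=> q _ [x Jx <-]; have [a <-] := qm_surj fq q.
  by exists (a * x * binv a); [apply: ideal_mconj | rewrite !(qmM fq) qmV].
- move=> q _ [x Jx <-]; have [a <-] := qm_surj fq q.
  by exists (blam a x); [apply: ideal_blam | rewrite qm_blam].
Qed.

Lemma preim_image J : ideal J -> (forall x, I x -> J x) -> preim (image J) = J.
Proof.
move=> idJ IJ; apply: set_ext => x; split=> [[y Jy /(qm_eq fq) yx]|Jx]; last by exists x.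
by have [i Ii ->] := congP yx; apply: idealD => //; apply: IJ.
Qed.

Lemma image_preim K : image (preim K) = K.
Proof.
apply: set_ext => q; split=> [[x Kx <-] //|Kq].
by have [x xq] := qm_surj fq q; exists x; rewrite ?/preim xq.
Qed.

Lemma preim_zero : preim (@bzeroset Q) = I.
Proof. by apply: set_ext => x; apply: qm_ker. Qed.
Lemma preim_full : preim (@bfull Q) = @bfull B. Proof. by []. Qed.

Lemma qm_section : exists g : Q -> B, forall q, f (g q) = q.
Proof. by exists (fun q => sval (cid (qm_surj fq q))) => q; case: cid. Qed.

Lemma soc_quot_preim K L : soc_quot (preim K) (preim L) <-> soc_quot K L.
Proof.
split=> h x Lx.
  have [y yx] := qm_surj fq x; rewrite -yx in Lx *; have [h1 h2] := h y Lx.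
  split=> b; have [c <-] := qm_surj fq b.
    by rewrite -qm_blam -cong_preim.
  by rewrite -!(qmD fq) -cong_preim.
have [h1 h2] := h (f x) Lx.
by split=> b; rewrite cong_preim ?qm_blam ?(qmD fq).
Qed.

Lemma infcyclic_quot_preim K L : infcyclic_quot (preim K) (preim L) <-> infcyclic_quot K L.
Proof.
split=> [[g [Lg gen tf]]|[q [Lq gen tf]]].
  exists (f g); split=> // [x Lx|n n0]; last by rewrite -qm_bmuln; apply: tf.
  have [y yx] := qm_surj fq x; rewrite -yx in Lx *.
  by have [z h] := gen y Lx; exists z; rewrite -qm_bmulz -cong_preim.
have [g gq] := qm_surj fq q; exists g; rewrite -gq in Lq gen tf; split=> // [x Lx|n n0].
  by have [z h] := gen _ Lx; exists z; rewrite cong_preim qm_bmulz.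
by rewrite /preim qm_bmuln; apply: tf.
Qed.

Lemma finite_quot_preim K L : finite_quot (preim K) (preim L) <-> finite_quot K L.
Proof.
have [g gK] := qm_section.
split=> [[n [h [Lh hP]]]|[n [h [Lh hP]]]].
  exists n, (fun i => f (h i)); split=> [|q]; first exact: Lh.
  rewrite -(gK q) => Lx; have [i lt_i hi] := hP _ Lx; exists i => //.
  by rewrite -cong_preim.
exists n, (fun i => g (h i)); split=> [i /Lh|x Lx]; first by rewrite /preim gK.
have [i lt_i hi] := hP _ Lx; exists i => //.
by rewrite cong_preim gK.
Qed.

Lemma prime_order_quot_preim K L :
  prime_order_quot (preim K) (preim L) <-> prime_order_quot K L.
Proof.
have [g gK] := qm_section.
split=> [[p [h [p_pr Lh inj hP]]]|[p [h [p_pr Lh inj hP]]]].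
  exists p, (fun i => f (h i)); split=> // [i j lt_i lt_j|q].
    by rewrite -cong_preim; apply: inj.
  rewrite -(gK q) => Lx; have [i lt_i hi] := hP _ Lx; exists i => //.
  by rewrite -cong_preim.
exists p, (fun i => g (h i)); split=> // [i /Lh|i j lt_i lt_j|x Lx].
- by rewrite /preim gK.
- by rewrite cong_preim !gK; apply: inj.
have [i lt_i hi] := hP _ Lx; exists i => //.
by rewrite cong_preim gK.
Qed.
End QuotientTransport.

(** * Chains of ideals *)

Section Chains.
Variable B : brace.
Implicit Types (I J K : B -> Prop) (step : (B -> Prop) -> (B -> Prop) -> Prop).

(** Equivalent to [ideal_chain], but peeling off the lowest factor, so that induction descends from
    the top ideal. *)
Inductive chain step : (B -> Prop) -> (B -> Prop) -> Prop :=
| chain_refl I : ideal I -> chain step I I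
| chain_step I J K : ideal I -> (forall x, I x -> J x) -> step I J ->
    chain step J K -> chain step I K.

Lemma chain_ideall step I J : chain step I J -> ideal I.
Proof. by case. Qed.

Lemma chain_sub step I J : chain step I J -> forall x, I x -> J x.
Proof. by elim=> // {}I J' K _ IJ _ _ IH x /IJ; apply: IH. Qed.

Lemma chain_trans step I J K : chain step I J -> chain step J K -> chain step I K.
Proof.
by move=> h; elim: h K => // {}I J' {}J idI sub st _ IH K /IH; apply: chain_step.
Qed.

Lemma chain1 step I J : ideal I -> ideal J -> (forall x, I x -> J x) ->
  step I J -> chain step I J.
Proof. by move=> idI idJ sub st; apply: (chain_step idI sub st); apply: chain_refl. Qed.

Lemma sub_chain (step step' : (B -> Prop) -> (B -> Prop) -> Prop) I J :
    (forall K L, ideal K -> ideal L -> step K L -> step' K L) ->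
  chain step I J -> chain step' I J.
Proof.
move=> sub; elim=> [K idK|K L M idK KL st ch IH]; first exact: chain_refl.
by apply: chain_step IH => //; apply: sub => //; apply: chain_ideall ch.
Qed.

Lemma ideal_chainP step I : ideal_chain I step <-> chain step I (@bfull B).
Proof.
split=> [[n [c [c0 cn cid cS cstep]]]|].
  have -> : I = c 0%N by apply: set_ext => x; rewrite c0.
  have -> : @bfull B = c n by apply: set_ext => x; split=> // _; apply: cn.
  (* Induction on the number [k] of topmost factors. *)
  suff h k : k <= n -> chain step (c (n - k)) (c n) by rewrite -(subnn n); apply: h.
  elim: k => [|k IHk] lt_k; first by rewrite subn0; apply/chain_refl/cid.
  have lt_nk : n - k.+1 < n by rewrite ltn_subrL (leq_trans _ lt_k).
  have E : n - k = (n - k.+1).+1 by rewrite -subSn // subSS.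
  apply: (@chain_step _ _ (c (n - k))).
  - exact/cid/leq_subr.
  - by move=> x; rewrite E; apply: cS.
  - by rewrite E; apply: cstep.
  - exact/IHk/ltnW.
move=> ch; have : forall x, @bfull B x by [].
elim: ch => [J idJ Jfull|J K L idJ JK st _ IH Lfull].
  by exists 0%N, (fun _ => J); split.
have [n [c [c0 cn cid cS cstep]]] := IH Lfull.
exists n.+1, (fun k => if k is k'.+1 then c k' else J); split=> //.
- by case=> // i /cid.
- by case=> [x _ /JK|i x]; [rewrite c0|apply: cS].
- case=> [_|i]; last exact: cstep.
  by rewrite (_ : c 0%N = K) //; apply: set_ext => x; rewrite c0.
Qed.
End Chains.

Definition ss_step (B : brace) (I J : B -> Prop) :=
  (infcyclic_quot I J /\ soc_quot I J) \/ prime_order_quot I J.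

Lemma supersoluble_quotP (B : brace) (I : B -> Prop) :
  supersoluble_quot I <-> chain (@ss_step B) I (@bfull B).
Proof. exact: ideal_chainP. Qed.

Section ChainTransport.
Variables (B Q : brace) (I : B -> Prop) (f : B -> Q).
Hypothesis fq : quotient_map I f.

Lemma ss_step_preim (K L : Q -> Prop) :
  ss_step (preim f K) (preim f L) <-> ss_step K L.
Proof.
by rewrite /ss_step (infcyclic_quot_preim fq) (soc_quot_preim fq) (prime_order_quot_preim fq).
Qed.

Lemma chain_ss_preim (K L : Q -> Prop) :
  chain (@ss_step Q) K L -> chain (@ss_step B) (preim f K) (preim f L).
Proof.
elim=> [{}K idK|{}K {}L M idK KL /ss_step_preim st _]; first exact/chain_refl/(ideal_preim fq).
by apply: chain_step => [|x|]; [exact: ideal_preim fq _ _|exact: KL|].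
Qed.

Lemma chain_ss_image (J J' : B -> Prop) : (forall x, I x -> J x) ->
  chain (@ss_step B) J J' -> chain (@ss_step Q) (image f J) (image f J').
Proof.
move=> IJ ch; elim: ch IJ => [{}J idJ IJ|{}J L {}J' idJ JL st ch IH IJ].
  exact/chain_refl/(ideal_image fq).
have IL x : I x -> L x by move=> /IJ/JL.
apply: chain_step (IH IL) => [|q [x Jx <-]|]; first exact: ideal_image fq _ _.
  by exists x; first exact: JL.
apply/ss_step_preim; rewrite !(preim_image fq) //; exact: chain_ideall ch.
Qed.

Lemma supersoluble_quot_preim (K : Q -> Prop) : ideal K ->
  (supersoluble_quot (preim f K) <-> supersoluble_quot K).
Proof.
move=> idK; rewrite !supersoluble_quotP; split; last first.
  by move=> /chain_ss_preim; rewrite preim_full.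
move/chain_ss_image; rewrite (image_preim fq) -{1}(preim_full f) (image_preim fq); apply.
by move=> x Ix; rewrite /preim (iffRL (qm_ker fq x) Ix); apply: ideal0.
Qed.
End ChainTransport.

(** * Factors of prime order and cyclic factors *)

Section Multiples.
Variable B : brace.
Implicit Types (x y : B) (J : B -> Prop).

Lemma bmulnSr x n : bmuln x n.+1 = bmuln x n + x.
Proof. by elim: n => [|n IHn] /=; rewrite ?badd0r ?badd0l // -baddA -IHn. Qed.

Lemma bmulnD x m n : bmuln x (m + n) = bmuln x m + bmuln x n.
Proof. by elim: m => [|m IHm] /=; rewrite ?badd0l // IHm baddA. Qed.

Lemma bmulnM x m n : bmuln x (m * n) = bmuln (bmuln x m) n.
Proof. by elim: n => [|n IHn]; rewrite ?muln0 //= mulnS bmulnD IHn. Qed.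

Lemma bmulnN x n : bmuln (- x) n = - bmuln x n.
Proof. by elim: n => [|n IHn]; rewrite ?bneg0 // bmulnSr bnegD /= IHn. Qed.

Lemma ideal_bmuln J x n : ideal J -> J x -> J (bmuln x n).
Proof. by move=> idJ Jx; elim: n => [|n IHn]; [apply: ideal0|apply: idealD]. Qed.

Lemma ideal_bmulz J x z : ideal J -> J x -> J (bmulz x z).
Proof.
by move=> idJ Jx; case: z => n; [|apply: idealN => //]; apply: ideal_bmuln.
Qed.

Lemma cong_bmuln J x y n : ideal J -> cong J x y -> cong J (bmuln x n) (bmuln y n).
Proof.
by move=> idJ xy; elim: n => [|n IHn]; [apply: cong_refl|apply: congD].
Qed.
End Multiples.

(* Translation by [x] permutes the [p] elements of [J]; all its orbits have the
   same size, which is therefore [p]. *)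
Lemma prime_order_generator0 (B : brace) (J : B -> Prop) (x : B) :
    ideal J -> prime_order_quot (@bzeroset B) J -> J x -> x <> 0 ->
  forall y, J y -> exists n, y = bmuln x n.
Proof.
move=> idJ [p [f [p_pr Jf f_inj fP]]] Jx x_neq0.
have fP' y : J y -> exists i : 'I_p, f i = y.
  by case/fP => i lt_i /cong_bzeroset; exists (Ordinal lt_i).
have finj (i j : 'I_p) : f i = f j -> i = j.
  by move=> E; apply/val_inj/f_inj; rewrite ?ltn_ord //; apply/cong_bzeroset.
have Jfx (i : 'I_p) : J (f i + x) by apply: idealD => //; apply: Jf.
pose t (i : 'I_p) : 'I_p := sval (cid (fP' _ (Jfx i))).
have tE i : f (t i) = f i + x by rewrite /t; case: cid.
have titer n i : f (iter n t i) = f i + bmuln x n.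
  elim: n => [|n IHn]; first by rewrite badd0r.
  by rewrite iterS tE IHn bmulnSr baddA.
have t_inj : injective t.
  move=> i j /(congr1 (fun k : 'I_p => f k)); rewrite !tE => E; apply: finj.
  by rewrite -(baddK (f i) x) E baddK.
(* Whether the [n]-th iterate of [t] fixes [i] is independent of [i]: it means that [n] times [x] is
   [0]. *)
have iterE n i : (iter n t i == i) = `[< bmuln x n = 0 >].
  apply/eqP/asboolP => [/(congr1 (fun k : 'I_p => f k))|E].
    by rewrite titer -[RHS]badd0r => /baddI.
  by apply: finj; rewrite titer E badd0r.
have order_le n i : (0 < n)%N -> iter n t i = i -> (fingraph.order t i <= n)%N.
  move=> n_gt0 E; rewrite leqNgt; apply/negP => lt_n.
  have : nth i (orbit t i) n = nth i (orbit t i) 0.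
    by rewrite !nth_traject // order_gt0.
  move/eqP; rewrite nth_uniq ?orbit_uniq ?size_orbit ?order_gt0 //.
  by move/eqP => n0; rewrite n0 in n_gt0.
have order_leq i j : (fingraph.order t i <= fingraph.order t j)%N.
  apply: order_le; rewrite ?order_gt0 //; apply/eqP.
  by rewrite iterE -(iterE _ j); apply/eqP/iter_order.
have order_eq i j : fingraph.order t i = fingraph.order t j.
  by apply/eqP; rewrite eqn_leq !order_leq.
move=> y Jy; have [i0 fi0] := fP' 0 (ideal0 idJ); have [j fj] := fP' y Jy.
have p_card : #|'I_p| = p by apply: card_ord.
have : (fingraph.order t i0 %| p)%N.
  rewrite -[X in (_ %| X)%N]p_card.
  rewrite -(@fcard_order_set _ t t_inj (fingraph.order t i0) 'I_p) ?dvdn_mull //.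
  by apply/subsetP => i _; rewrite inE (order_eq i i0).
(* Orbits of size [1] would give [x = 0]; with size [p], the orbit of the index of [0] is
   everything, so each [y] is a multiple of [x]. *)
case/primeP: p_pr => _ h /h /orP[/eqP o1|/eqP op].
  case: x_neq0; have := iter_order t_inj i0; rewrite o1 => /eqP.
  by rewrite iterE => /asboolP /=; rewrite badd0r.
have : fconnect t i0 j.
  have E : fconnect t i0 =i 'I_p.
    apply/subset_cardP; first by rewrite p_card.
    by apply/subsetP => i _; rewrite inE.
  by rewrite -[fconnect t i0 j]/(j \in fconnect t i0) E.
move/iter_findex => E; exists (findex t i0 j).
by have := titer (findex t i0 j) i0; rewrite E fj fi0 badd0l.
Qed.

Section Generator.
Variables (B : brace) (I J : B -> Prop).
Hypotheses (idI : ideal I) (idJ : ideal J) (IJ : forall x, I x -> J x).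

Lemma prime_order_generator (x : B) :
    prime_order_quot I J -> J x -> ~ I x ->
  forall y, J y -> exists n, cong I (bmuln x n) y.
Proof.
have [Q [f fq]] := exists_quotient idI.
rewrite -(preim_image fq idJ IJ) -{1}(preim_zero fq).
move=> /(prime_order_quot_preim fq) pJ Jx Ix y Jy.
have [|n E] := prime_order_generator0 (ideal_image fq idJ) pJ Jx _ Jy.
  by move/(qm_ker fq).
by exists n; apply/(qm_eq fq); rewrite (qm_bmuln fq).
Qed.
End Generator.

Section Socle.
Variables (B : brace) (K L : B -> Prop).
Hypotheses (idK : ideal K) (socKL : soc_quot K L).
Implicit Types (x y b : B) (S : B -> Prop).

(** Modulo [K], elements of [L] are additively central and act trivially: products in [S] are sums,
    and [a * x * binv a] is congruent to [blam a x]. *)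
Lemma soc_subgroup_ideal S :
    (forall x, K x -> S x) -> (forall x, S x -> L x) -> subgroup_add S ->
    (forall b x, S x -> S (blam b x)) ->
  ideal S.
Proof.
move=> KS SL [S0 [SD SN]] Slam.
have Scong x y : S x -> cong K x y -> S y.
  by move=> Sx /congP[i /KS Ki ->]; apply: SD.
split; first split=> //.
- split; first by rewrite bone0.
  split=> [x y Sx Sy|x Sx]; last by rewrite binvE; apply/Slam/SN.
  rewrite bmulE; apply: (SD _ _ Sx); apply: (Scong y) => //.
  by apply/(cong_sym idK)/(socKL (SL _ Sx)).1.
- move=> a x Sx; apply: (Scong (x + a + - a)); first by rewrite baddK.
  by apply: congD => //; [exact: (socKL (SL _ Sx)).2|exact: cong_refl].
- move=> a x Sx.
  have [k Kk Ek] : exists2 k, K k & blam x (binv a) = binv a + k.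
    by apply: congP; apply/(cong_sym idK)/(socKL (SL _ Sx)).1.
  have -> : a * x * binv a = a + blam a x + - a + blam a k.
    rewrite -bmulA (bmulE x) Ek bmulE !blamD !baddA.
    by congr (_ + _ + _); rewrite /blam bmulVr bone0 badd0r.
  apply: SD; last by apply: KS; apply: ideal_blam.
  have Sy := Slam a _ Sx; apply: (Scong (blam a x + a + - a)); first by rewrite baddK.
  by apply: congD => //; [exact: (socKL (SL _ Sy)).2|exact: cong_refl].
- exact: Slam.
Qed.
End Socle.

Lemma blam_bmuln (B : brace) (b x : B) n : blam b (bmuln x n) = bmuln (blam b x) n.
Proof. by elim: n => [|n IHn]; rewrite ?blam0 //= blamD IHn. Qed.

Section CyclicQuotient.
Variable B : brace.
Implicit Types (K L S : B -> Prop) (g x y : B).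

(** As [n g] lies in [K], the opposite of [k g] is congruent to [(n - 1) k g]: natural multiples
    exhaust the cyclic group. Truncation does not occur because [0 < n]. *)
Lemma cong_neg_bmuln K g n k : ideal K -> (0 < n)%N -> K (bmuln g n) ->
  cong K (bmuln g (n * k - k)) (- bmuln g k).
Proof.
move=> idK n_gt0 Kn; rewrite /cong -bnegD -bmulnD subnKC ?leq_pmull //.
by rewrite bmulnM; apply: (idealN idK); apply: ideal_bmuln.
Qed.

Lemma prime_order_cyclic S L g p : ideal S -> ideal L -> prime p -> L g ->
    ~ S g -> S (bmuln g p) ->
    (forall x, L x -> exists n, cong S (bmuln g n) x) ->
  prime_order_quot S L.
Proof.
move=> idS idL p_pr Lg Sg Spg gen; exists p, (bmuln g); split=> //.
- by move=> i _; apply: ideal_bmuln.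
- have lt_case i j : (i < j)%N -> (j < p)%N -> ~ cong S (bmuln g i) (bmuln g j).
    move=> ij jp; rewrite -(subnKC (ltnW ij)) bmulnD /cong baddKl => Sd.
    set d := (j - i)%N in Sd.
    (* Bezout: [d u = v p + 1], so having both [d g] and [p g] in [S] would put [g] in [S]. *)
    have /coprimeP : coprime d p.
      by rewrite coprime_sym prime_coprime // gtnNdvd /d ?subn_gt0 //; lia.
    rewrite subn_gt0 => /(_ ij)[[u v] /= E].
    apply: Sg; have : S (bmuln g (v * p + 1)).
      have -> : (v * p + 1 = d * u)%N by rewrite [(d * u)%N]mulnC; lia.
      by rewrite bmulnM; apply: ideal_bmuln.
    rewrite bmulnD mulnC bmulnM /= badd0r => Sg.
    rewrite -(baddKl (bmuln (bmuln g p) v) g); apply: idealD => //.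
    by apply: (idealN idS); apply: ideal_bmuln.
  move=> i j lt_i lt_j ij; apply/eqP; rewrite eqn_leq; apply/andP; split; rewrite leqNgt;
    apply/negP => /lt_case; first by apply=> //; apply: cong_sym.
  by apply.
move=> x /gen[n nx]; exists (n %% p)%N; first by rewrite ltn_mod prime_gt0.
apply: cong_trans nx => //; rewrite {2}(divn_eq n p) bmulnD [(n %/ p * p)%N]mulnC bmulnM.
rewrite -{1}(badd0l (bmuln g (n %% p))); apply: congD => //; last exact: cong_refl.
by rewrite cong0; apply: ideal_bmuln.
Qed.

(** Induction on [n]. For a prime divisor [p] of [n], let [S] be generated by [p g] over [K]. The
    factor [S / K] is handled with [n / p], and [L / S] is trivial or of order [p]. *)
Lemma cyclic_chain K L g n : ideal K -> ideal L -> (forall x, K x -> L x) ->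
    soc_quot K L -> L g -> (0 < n)%N -> K (bmuln g n) ->
    (forall x, L x -> exists n, cong K (bmuln g n) x) ->
  chain (@prime_order_quot B) K L.
Proof.
move=> idK idL KL soc Lg n_gt0.
have [m] := ubnP n; elim: m L g n n_gt0 idL KL soc Lg => // m IHm L g n n_gt0 idL KL soc Lg.
rewrite ltnS => le_n Kng gen.
case: (leqP n 1) => [n_le1|n_gt1].
  have n1 : n = 1%N by lia.
  rewrite n1 /= badd0r in Kng.
  have -> : L = K; last exact: chain_refl.
  apply: set_ext => x; split=> [/gen[k /congP[i Ki ->]]|]; last exact: KL.
  by apply: idealD => //; apply: ideal_bmuln.
set p := pdiv n; have p_pr : prime p by apply: pdiv_prime.
have [q nE] : exists q, n = (p * q)%N.
  by have /dvdnP[q ->] := pdiv_dvd n; exists q; rewrite mulnC.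
have q_gt0 : (0 < q)%N by move: n_gt0; rewrite nE muln_gt0 => /andP[].
have q_lt : (q < n)%N by rewrite nE ltn_Pmull ?prime_gt1.
pose h := bmuln g p; pose S x := exists k, cong K (bmuln h k) x.
have Kqh : K (bmuln h q) by rewrite -bmulnM -nE.
have KS x : K x -> S x by move=> Kx; exists 0%N; rewrite cong0.
have Lh : L h by apply: ideal_bmuln.
have SL x : S x -> L x.
  by move=> [k /congP[i /KL Li ->]]; apply: idealD => //; apply: ideal_bmuln.
have idS : ideal S.
  apply: (soc_subgroup_ideal idK soc) => //.
    split; first by apply: KS; apply: ideal0.
    split=> [x y [k kx] [l ly]|x [k kx]].
      by exists (k + l)%N; rewrite bmulnD; apply: congD.
    exists (q * k - k)%N; apply: cong_trans (cong_neg_bmuln k idK q_gt0 Kqh) _ => //.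
    have /congP[i Ki ->] := kx; rewrite bnegD /cong bnegK.
    by have := ideal_conj idK (bmuln h k) (idealN idK Ki); rewrite -baddA.
  move=> b x [k /congP[i Ki ->]].
  have /gen[l lE] : L (blam b g) by apply: ideal_blam.
  (* [blam b] sends [g] to [l g] modulo [K], hence [k h] to [l k h]. *)
  exists (l * k)%N; apply: (@cong_trans _ _ _ _ (blam b (bmuln h k))) => //.
    rewrite /h -!bmulnM blam_bmuln mulnA [(p * l)%N]mulnC -mulnA bmulnM.
    exact: cong_bmuln.
  by rewrite blamD /cong baddKl; apply: ideal_blam.
have chS : chain (@prime_order_quot B) K S.
  apply: (IHm S h q) => //.
  - by move=> x Sx; exact: soc (SL x Sx).
  - by exists 1%N; rewrite /= badd0r; apply: cong_refl.
  - exact: leq_trans le_n.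
(* [n] is only a multiple of the order of [g] modulo [K], so [S] may already be all of [L]. *)
have [Sg|nSg] := pselect (S g).
  have <- // : S = L; apply: set_ext => x; split=> [/SL //|/gen[k /congP[i /KS Si ->]]].
  by apply: idealD => //; apply: ideal_bmuln.
apply: chain_trans chS _; apply: chain1 => //.
apply: (@prime_order_cyclic S L g p) => //.
  by exists 1%N; rewrite /= badd0r; apply: cong_refl.
by move=> x /gen[k /congP[i /KS Si ->]]; exists k; rewrite /cong baddKl.
Qed.

Lemma infcyclic_cong_nat K g n x : ideal K -> (0 < n)%N -> K (bmuln g n) ->
  (exists z, cong K (bmulz g z) x) -> exists k, cong K (bmuln g k) x.
Proof.
move=> idK n_gt0 Kn [[k|k]] kx; first by exists k.
by exists (n * k.+1 - k.+1)%N; apply: cong_trans kx => //; apply: cong_neg_bmuln.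
Qed.

(** Pigeonhole: two of the [n + 1] first multiples of [x] lie in the same class, and their
    difference is a multiple of [x] in [K]. *)
Lemma finite_quot_torsion K L x : ideal K -> ideal L -> finite_quot K L -> L x ->
  exists2 n, (0 < n)%N & K (bmuln x n).
Proof.
move=> idK idL [n [f [Lf fP]]] Lx.
have rep (k : 'I_n.+1) : exists i : 'I_n, cong K (f i) (bmuln x k).
  have [i lt_i h] := fP _ (ideal_bmuln k idL Lx).
  by exists (Ordinal lt_i).
pose r k := sval (cid (rep k)).
have rP k : cong K (f (r k)) (bmuln x k) by rewrite /r; case: cid.
have : ~~ injectiveb r by apply/negP => /injectiveP/leq_card; rewrite !card_ord ltnn.
case/injectivePn => k [l ne E].
wlog lt_kl : k l ne E / (k < l)%N => [wl|].
  case: (ltngtP k l) => h; [exact: (wl k l)|apply: (wl l k) => //; by rewrite eq_sym|].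
  by case/eqP: ne; apply/val_inj.
exists (l - k)%N; first by rewrite subn_gt0.
have rl := rP l; rewrite -E in rl.
have := cong_trans idK (cong_sym idK (rP k)) rl.
by rewrite -{1}(subnKC (ltnW lt_kl)) bmulnD /cong baddKl.
Qed.
End CyclicQuotient.

(** * Supersoluble chains in finite quotients and inside torsion ideals *)

Section FiniteImage.
Variables (B Q : brace) (I : B -> Prop) (f : B -> Q).
Hypothesis fq : quotient_map I f.
Hypothesis finQ : finite_quot (@bzeroset Q) (@bfull Q).

Lemma soc_quot_image (J L : B -> Prop) :
  soc_quot J L -> soc_quot (image f J) (image f L).
Proof.
move=> soc _ [x Lx <-]; have [h1 h2] := soc x Lx; split=> b; have [c <-] := qm_surj fq b.
  by exists (- blam x c + c); [exact: h1|rewrite (qmD fq) (qmN fq) (qm_blam fq)].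
by exists (- (x + c) + (c + x)); [exact: h2|rewrite (qmD fq) (qmN fq) !(qmD fq)].
Qed.

Lemma bfull_ideal (A : brace) : ideal (@bfull A). Proof. by []. Qed.

Lemma cong_image (J : B -> Prop) x y : cong J x y -> cong (image f J) (f x) (f y).
Proof. by move=> Jxy; exists (- x + y); rewrite // (qmD fq) (qmN fq). Qed.

(* An infinite cyclic factor may become finite cyclic in the image, and is then
   refined into factors of prime order. *)
Lemma chain_finite_image (J J' : B -> Prop) :
  chain (@ss_step B) J J' -> chain (@ss_step Q) (image f J) (image f J').
Proof.
elim=> [{}J idJ|{}J L {}J' idJ JL st ch IH].
  exact/chain_refl/(ideal_image fq).
apply: chain_trans IH.
have idL := chain_ideall ch.
have idfJ := ideal_image fq idJ; have idfL := ideal_image fq idL.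
have fJL q : image f J q -> image f L q by move=> [x /JL]; exists x.
case: st => [[[g [Lg gen _]] soc]|pJL].
  have [n n_gt0 n0] :=
    finite_quot_torsion (bzeroset_ideal Q) (@bfull_ideal Q) finQ (Logic.I : bfull (f g)).
  apply: (@sub_chain _ (@prime_order_quot Q)) => [K K' _ _|]; first by right.
  have fJn : image f J (bmuln (f g) n) by rewrite n0; exists 0; [apply: ideal0|apply: qm0 fq].
  apply: (@cyclic_chain _ _ _ (f g) n) => //; first exact: soc_quot_image.
    by exists g.
  move=> _ [x Lx <-]; apply: infcyclic_cong_nat n_gt0 fJn _ => //.
  by have [z h] := gen x Lx; exists z; rewrite -(qm_bmulz fq); apply: cong_image.
have [sub|nsub] := pselect (forall q, image f L q -> image f J q).
  have -> : image f L = image f J by apply: set_ext => q; split; [apply: sub|apply: fJL].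
  exact: chain_refl.
apply: chain1 => //; right.
have [p [h [p_pr Lh inj hP]]] := pJL.
exists p, (fun i => f (h i)); split=> // [i lt_i|i j lt_i lt_j fij|_ [x Lx <-]].
- by exists (h i); first exact: Lh.
(* If two representatives become congruent, their difference generates [L] modulo [J] and maps into
   the image of [J], so the two images coincide. *)
- apply: contrapT => ne; apply: nsub => _ [y Ly <-].
  have Lx : L (- h i + h j) by apply: idealD (Lh j lt_j) => //; apply: (idealN idL); apply: Lh.
  have Jx : ~ J (- h i + h j) by move=> /(inj i j lt_i lt_j).
  have [n /congP[k Jk ->]] := prime_order_generator idJ idL JL pJL Lx Jx Ly.
  rewrite (qmD fq) (qm_bmuln fq); apply: idealD => //; last by exists k.
  by apply: ideal_bmuln => //; rewrite (qmD fq) (qmN fq).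
have [i lt_i hi] := hP x Lx; exists i => //; exact: cong_image.
Qed.
End FiniteImage.

Theorem supersoluble_finite_image (B : brace) (I : B -> Prop) :
  supersoluble B -> ideal I -> finite_quot I (@bfull B) -> supersoluble_quot I.
Proof.
move=> /supersoluble_quotP ch idI fin; have [Q [f fq]] := exists_quotient idI.
have := fin; rewrite -{1}(preim_zero fq) -{1}(preim_full f) => /(finite_quot_preim fq) finQ.
rewrite -(preim_zero fq) (supersoluble_quot_preim fq); last exact: bzeroset_ideal.
apply/supersoluble_quotP; have := chain_finite_image fq finQ ch.
have -> : image f (@bfull B) = @bfull Q.
  by apply: set_ext => q; split=> // _; have [x <-] := qm_surj fq q; exists x.
have -> // : image f (@bzeroset B) = @bzeroset Q.
apply: set_ext => q; split=> [[x -> <-]|->]; first exact: qm0 fq.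
by exists 0 => //; apply: qm0 fq.
Qed.

Lemma idealI (B : brace) (J F : B -> Prop) :
  ideal J -> ideal F -> ideal (fun x => J x /\ F x).
Proof.
move=> idJ idF; split; first split.
- split; first by split; apply: ideal0.
  by split=> [x y [Jx Fx] [Jy Fy]|x [Jx Fx]]; split; (apply: idealD || apply: idealN).
- split; first by rewrite bone0; split; apply: ideal0.
  by split=> [x y [Jx Fx] [Jy Fy]|x [Jx Fx]]; split; (apply: idealM || apply: idealV).
- by move=> a x [Jx Fx]; split; apply: ideal_conj.
- by move=> a x [Jx Fx]; split; apply: ideal_mconj.
- by move=> a x [Jx Fx]; split; apply: ideal_blam.
Qed.

(** Every term is intersected with [F]. Being torsion modulo [J], [F] adds nothing across an
    infinite cyclic factor; a factor of prime order either disappears or is generated by an element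
    of [F]. *)
Lemma chain_cap (B : brace) (J J' F : B -> Prop) : ideal F ->
    (forall x, F x -> exists2 n, (0 < n)%N & J (bmuln x n)) ->
    chain (@ss_step B) J J' ->
  chain (@prime_order_quot B) (fun x => J x /\ F x) (fun x => J' x /\ F x).
Proof.
move=> idF tor ch; elim: ch tor => [{}J idJ _|{}J L {}J' idJ JL st ch IH tor].
  exact/chain_refl/idealI.
have idL := chain_ideall ch.
have torL x : F x -> exists2 n, (0 < n)%N & L (bmuln x n).
  by move=> /tor[n n_gt0 /JL]; exists n.
apply: chain_trans (IH torL).
have [sub|nsub] := pselect (forall x, L x /\ F x -> J x).
  have -> : (fun x => L x /\ F x) = (fun x => J x /\ F x).
    apply: set_ext => x; split=> [[Lx Fx]|[/JL Lx Fx] //]; split=> //; exact: sub.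
  exact/chain_refl/idealI.
have [x [Lx Fx Jx]] : exists x, [/\ L x, F x & ~ J x].
  apply: contrapT => no; apply: nsub => x [Lx Fx]; apply: contrapT => Jx.
  by apply: no; exists x.
case: st => [[[g [Lg gen tf]] _]|pJL].
  case: Jx; have [z zx] := gen x Lx; have [n n_gt0 Jn] := tor x Fx.
  have Jz : J (bmuln (bmulz g z) n).
    rewrite -cong0; apply: (cong_trans idJ) (cong_bmuln n idJ (cong_sym idJ zx)).
    by rewrite cong0.
  rewrite -cong0; apply: (cong_trans idJ) zx; rewrite cong0.
  case: z Jz => [[|k]|k] /=; first by move=> _; apply: ideal0.
    by rewrite -[badd g _]/(bmuln g k.+1) -bmulnM => /tf; case; rewrite muln_gt0.
  move=> Jz; case: (tf (k.+1 * n)%N); first by rewrite muln_gt0.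
  have := idealN idJ Jz; rewrite -[badd g _]/(bmuln g k.+1) bmulnN bnegK.
  by rewrite bmulnM.
apply: chain1; [exact: idealI|exact: idealI|by move=> y [/JL]|].
have gen y : L y -> exists n, cong J (bmuln x n) y.
  by apply: (prime_order_generator idJ idL JL pJL Lx Jx).
have [p [h [p_pr Lh inj hP]]] := pJL.
(* The representatives [h i] may lie outside [F]; they are replaced by multiples of [x], which lie
   in [F], in the same classes modulo [J]. *)
have [e eP] : exists e : nat -> nat, forall i, (i < p)%N -> cong J (bmuln x (e i)) (h i).
  have rep i : exists n, (i < p)%N -> cong J (bmuln x n) (h i).
    case: (ltnP i p) => [/Lh/gen[n hn]|_]; last by exists 0%N.
    by exists n.
  by exists (fun i => sval (cid (rep i))) => i lt_i; case: cid => /= n; apply.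
have LF i : L (bmuln x (e i)) /\ F (bmuln x (e i)) by split; apply: ideal_bmuln.
exists p, (fun i => bmuln x (e i)); split=> // [i j lt_i lt_j [ij _]|y [Ly Fy]].
  apply: inj => //; apply: (cong_trans idJ) (eP j lt_j).
  by apply: (cong_trans idJ) ij; apply/(cong_sym idJ)/eP.
have [i lt_i hi] := hP y Ly; exists i => //; split.
  by apply: (cong_trans idJ) hi; apply: eP.
by apply: idealD => //; apply: (idealN idF); apply: (LF i).2.
Qed.

(** * Socle elements and residual finiteness *)

Section SocleElements.
Variable B : brace.
Implicit Types (x y b c : B).

Definition soc x := (forall b, blam x b = b) /\ (forall b, x + b = b + x).

Lemma soc_quot0P (L : B -> Prop) :
  soc_quot (@bzeroset B) L <-> forall x, L x -> soc x.
Proof.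
split=> h x /h[h1 h2]; split=> b.
- exact/cong_bzeroset.
- exact/cong_bzeroset.
- exact/cong_bzeroset.
- exact/cong_bzeroset.
Qed.

Lemma soc0 : soc 0.
Proof. by split=> b; rewrite ?blam0l // badd0l badd0r. Qed.

Lemma soc_mulE x y : soc x -> x * y = x + y.
Proof. by case=> h _; rewrite bmulE h. Qed.

Lemma socD x y : soc x -> soc y -> soc (x + y).
Proof.
move=> sx sy; split=> b; first by rewrite -soc_mulE // blamM sy.1 sx.1.
by rewrite -baddA sy.2 baddA sx.2 baddA.
Qed.

Lemma soc_binvE x : soc x -> binv x = - x.
Proof. by move=> sx; apply: binv_eq; rewrite soc_mulE // baddNr bone0. Qed.

Lemma socN x : soc x -> soc (- x).
Proof.
move=> sx; split=> b; first by rewrite -soc_binvE // -{1}[b](sx.1) blamK.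
by apply: (@baddI _ x); rewrite baddNKl baddA sx.2 -baddA baddNr badd0r.
Qed.

Lemma soc_blamE x b : soc x -> blam b x = b * x * binv b.
Proof.
move=> sx; have cy c : blam b x + c = c + blam b x.
  by rewrite -(blamVK b c) -!blamD sx.2.
have E : blam b (binv b) = - b by rewrite /blam bmulVr bone0 badd0r.
by rewrite -bmulA (soc_mulE _ sx) bmulE blamD E baddA -cy baddK.
Qed.

(** [blam b x] is the multiplicative conjugate of [x] by [b], so its action is a conjugate of the
    trivial one. *)
Lemma soc_blam x b : soc x -> soc (blam b x).
Proof.
move=> sx; split=> c; first by rewrite (soc_blamE b sx) !blamM sx.1 blamVK.
by rewrite -(blamVK b c) -!blamD sx.2.
Qed.

Lemma soc_bmuln x n : soc x -> soc (bmuln x n).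
Proof. by move=> sx; elim: n => [|n IHn]; [exact: soc0|apply: socD]. Qed.

Lemma bmuln_centralD x y n : (forall b, x + b = b + x) ->
  bmuln (x + y) n = bmuln x n + bmuln y n.
Proof.
move=> cx; elim: n => [|n IHn]; first by rewrite badd0l.
rewrite /= IHn -!baddA; congr (_ + _); rewrite !baddA; congr (_ + _).
by elim: n {IHn} => [|n IHn] /=; rewrite ?badd0l ?badd0r // baddA -cx -baddA IHn baddA.
Qed.

Lemma bmuln_bmulz x a n : bmuln (bmulz x a) n = bmulz (bmuln x n) a.
Proof.
by case: a => k; rewrite /bmulz ?bmulnN -!bmulnM mulnC.
Qed.

Lemma cong_bmulz (J : B -> Prop) x y a :
  ideal J -> cong J x y -> cong J (bmulz x a) (bmulz y a).
Proof.
move=> idJ xy; have h n := cong_bmuln n idJ xy.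
case: a => n; rewrite /bmulz //.
have [j Jj ->] := congP (h n.+1); rewrite bnegD /cong bnegK.
by have := ideal_conj idJ (bmuln x n.+1) (idealN idJ Jj); rewrite -baddA.
Qed.

(* Differences of natural multiples, so that no arithmetic of [bmulz] is needed. *)
Definition socspan x : B -> Prop := fun y => exists i j, y = bmuln x i + - bmuln x j.

Lemma socspan_self x : socspan x x.
Proof. by exists 1%N, 0%N; rewrite /= badd0r bneg0 badd0r. Qed.

Lemma socspan_bmulz x a : socspan x (bmulz x a).
Proof.
case: a => n; first by exists n, 0%N; rewrite /= bneg0 badd0r.
by exists 0%N, n.+1; rewrite badd0l.
Qed.

Lemma socspan_soc x y : soc x -> socspan x y -> soc y.
Proof. by move=> sx [i [j ->]]; apply: socD; [|apply: socN]; apply: soc_bmuln. Qed.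

Lemma socspan_add x : soc x -> subgroup_add (socspan x).
Proof.
move=> sx; split; first by exists 0%N, 0%N; rewrite /= badd0l bneg0.
split=> [_ _ [i [j ->]] [k [l ->]]|_ [i [j ->]]].
  exists (i + k)%N, (l + j)%N; rewrite !bmulnD bnegD -!baddA; congr (_ + _).
  by rewrite !baddA; congr (_ + _); rewrite (soc_bmuln k sx).2.
by exists j, i; rewrite bnegD bnegK.
Qed.

Lemma socspan_ideal x :
  soc x -> (forall b, socspan x (blam b x)) -> ideal (socspan x).
Proof.
move=> sx lamx; apply: (@soc_subgroup_ideal B (@bzeroset B) (socspan x)) => //.
- exact: bzeroset_ideal.
- by apply/soc_quot0P => y; apply: socspan_soc.
- by move=> _ ->; exists 0%N, 0%N; rewrite badd0l bneg0.
- exact: socspan_add.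
have [S0 [SD SN]] := socspan_add sx.
have Sn n y : socspan x y -> socspan x (bmuln y n).
  by move=> Sy; elim: n => [|n IHn] //=; apply: SD.
move=> b _ [i [j ->]]; rewrite blamD blamN !blam_bmuln.
by apply: SD; [|apply: SN]; apply: Sn.
Qed.
End SocleElements.

(** * Finite factors and finite generation of additive groups *)

Section Finiteness.
Variable B : brace.
Implicit Types (I J K L : B -> Prop).

Lemma finite_quotI (T : finType) (h : T -> B) I J :
    (forall t, J (h t)) -> (forall x, J x -> exists t, cong I (h t) x) ->
  finite_quot I J.
Proof.
move=> Jh hP.
(* Indices from [#|T|] on get the default value [0]. *)
exists #|T|, (fun i => if insub i is Some k then h (enum_val (k : 'I_#|T|)) else 0).
split=> [i lt_i|x /hP[t ht]]; first by rewrite insubT.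
by exists (enum_rank t) => //; rewrite valK enum_rankK.
Qed.

Lemma finite_quotP I J : finite_quot I J ->
  exists n (h : 'I_n -> B), (forall t, J (h t)) /\ (forall x, J x -> exists t, cong I (h t) x).
Proof.
move=> [n [f [Jf fP]]]; exists n, (fun i => f i).
split=> [i|x /fP[i lt_i fi]]; first exact: Jf.
by exists (Ordinal lt_i).
Qed.

Lemma finite_quot_trans I J K : ideal I -> ideal J -> ideal K -> (forall x, I x -> J x) ->
  (forall x, J x -> K x) -> finite_quot I J -> finite_quot J K -> finite_quot I K.
Proof.
move=> idI idJ idK IJ JK /finite_quotP[m [h [Jh hP]]] /finite_quotP[n [k [Kk kP]]].
apply: (@finite_quotI ('I_n * 'I_m)%type (fun t => k t.1 + h t.2)).
  by move=> t; apply: idealD => //; apply: JK.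
move=> x /kP[i /congP[j /hP[l lj] ->]]; exists (i, l) => /=.
by apply: congD => //; apply: cong_refl.
Qed.

(** The product of the torsion exponents of the finitely many representatives serves all classes. *)
Lemma finite_quot_exponent I J : ideal I -> ideal J -> finite_quot I J ->
  exists2 e, (0 < e)%N & forall x, J x -> I (bmuln x e).
Proof.
move=> idI idJ fin; have [n [h [Jh hP]]] := finite_quotP fin.
pose e i := s2val (cid2 (finite_quot_torsion idI idJ fin (Jh i))).
have e_gt0 i : (0 < e i)%N by rewrite /e; case: cid2.
have eP i : I (bmuln (h i) (e i)) by rewrite /e; case: cid2.
exists (\prod_i e i)%N => [|x /hP[i hi]]; first exact: prodn_gt0.
rewrite -cong0; apply: (cong_trans idI) (cong_bmuln _ idI hi); rewrite cong0.
by rewrite (bigD1 i) //= bmulnM; apply: ideal_bmuln.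
Qed.

(** [J] lies in the additive subgroup generated by [I] and the [s i]. Quantifying over [H] allows
    taking for [H] the set where two additive maps agree. *)
Definition fg_add_quot I J := exists m (s : 'I_m -> B), forall H : B -> Prop,
  subgroup_add H -> (forall x, I x -> H x) -> (forall i, H (s i)) ->
  forall x, J x -> H x.

Lemma fg_add_quot_trans I J K :
  fg_add_quot I J -> fg_add_quot J K -> fg_add_quot I K.
Proof.
move=> [m [s sP]] [n [t tP]].
exists (m + n)%N, (fun i => match split i with inl i => s i | inr i => t i end).
move=> H sgH IH sH; apply: tP => // [x Jx|i].
  by apply: sP Jx => // i; have := sH (lshift n i); rewrite (unsplitK (inl i)).
by have := sH (rshift m i); rewrite (unsplitK (inr i)).
Qed.

Lemma finite_fg_add_quot I J : finite_quot I J -> fg_add_quot I J.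
Proof.
move=> /finite_quotP[n [h [Jh hP]]].
exists n, h => H [_ [HD _]] IH Hh x /hP[t /congP[i Ii ->]].
by apply: HD => //; apply: IH.
Qed.

Lemma ss_step_fg_add I J : ss_step I J -> fg_add_quot I J.
Proof.
case=> [[[g [Jg gen _]] _]|[p [f [_ Jf _ fP]]]]; last first.
  by apply: finite_fg_add_quot; exists p, f.
exists 1%N, (fun _ => g) => H [H0 [HD HN]] IH /(_ ord0) Hg x /gen[z /congP[i /IH Hi ->]].
have Hn n : H (bmuln g n) by elim: n => // n Hn; apply: HD.
by apply: HD => //; case: z => n; [|apply: HN]; apply: Hn.
Qed.

Lemma chain_fg_add I J : chain (@ss_step B) I J -> fg_add_quot I J.
Proof.
elim=> [K idK|K L M idK KL /ss_step_fg_add st _ IH].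
  by exists 0%N, (fun _ => 0) => H _ KH _.
exact: fg_add_quot_trans st IH.
Qed.
End Finiteness.

Section SeparateFinite.
Variables (B : brace) (F K : B -> Prop).
Hypotheses (idF : ideal F) (idK : ideal K) (FK : forall x, F x -> K x).
Hypotheses (finF : finite_quot (@bzeroset B) F).
Hypotheses (cycK : infcyclic_quot F K) (socK : soc_quot F K).
Hypothesis fgB : fg_add_quot (@bzeroset B) (@bfull B).

(* Elements of [K] act on [(B,+)], through [lambda] and by conjugation, trivially
   modulo the finite ideal [F]; as [(B,+)] is finitely generated, two multiples of
   a generator of [K] modulo [F] act in the same way. *)
Lemma exists_same_action (g : B) : K g -> exists k l, [/\ (k < l)%N,
  forall b, blam (bmuln g k) b = blam (bmuln g l) b &
  forall b, bmuln g k + b + - bmuln g k = bmuln g l + b + - bmuln g l].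
Proof.
move=> Kg; have [q [h [Fh hP]]] := finite_quotP finF.
have hP' x : F x -> exists i, h i = x by move=> /hP[i /cong_bzeroset]; exists i.
have [m [s sP]] := fgB.
have Fl k j : F (- s j + blam (bmuln g k) (s j)).
  by apply/(cong_sym idF)/(socK (ideal_bmuln k idK Kg)).1.
have Fc k j : F (- s j + (bmuln g k + s j + - bmuln g k)).
  have := (socK (ideal_bmuln k idK Kg)).2 (s j) => /(cong_sym idF) h1.
  have := congD idF h1 (cong_refl idF (- bmuln g k)).
  by rewrite baddK.
(* [r k] records, for each [s j], the elements of [F] by which the two actions of [k g] displace it.
   There are finitely many such tables, so two multiples share one. *)
pose r (k : 'I_(#|{ffun 'I_m -> 'I_q * 'I_q}|.+1)) : {ffun 'I_m -> 'I_q * 'I_q} :=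
  [ffun j => (sval (cid (hP' _ (Fl k j))), sval (cid (hP' _ (Fc k j))))].
have r1 k j : h (r k j).1 = - s j + blam (bmuln g k) (s j).
  by rewrite /r ffunE /=; case: cid.
have r2 k j : h (r k j).2 = - s j + (bmuln g k + s j + - bmuln g k).
  by rewrite /r ffunE /=; case: (cid (hP' _ (Fc _ _))).
have : ~~ injectiveb r by apply/negP => /injectiveP/leq_card; rewrite card_ord ltnn.
case/injectivePn => k [l ne E].
suff act : forall i j : 'I_(#|{ffun 'I_m -> 'I_q * 'I_q}|.+1), r i = r j ->
    (forall b, blam (bmuln g i) b = blam (bmuln g j) b) /\
    (forall b, bmuln g i + b + - bmuln g i = bmuln g j + b + - bmuln g j).
  have := ne; rewrite -val_eqE neq_ltn => /orP[lt|lt].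
    by exists k, l; have [] := act k l E.
  by exists l, k; have [] := act l k (esym E).
(* The elements on which two actions agree form an additive subgroup, and it contains every
   [s j]. *)
move=> i j rij; split=> b.
  apply: (sP (fun b => blam (bmuln g i) b = blam (bmuln g j) b)) => //.
  - split; first by rewrite !blam0.
    by split=> [x y Ex Ey|x Ex]; rewrite ?blamD ?blamN ?Ex ?Ey.
  - by move=> _ ->; rewrite !blam0.
  - by move=> t; apply: (@baddI _ (- s t)); rewrite -!r1 rij.
apply: (sP (fun b => bmuln g i + b + - bmuln g i = bmuln g j + b + - bmuln g j)) => //.
- have conjD (u x y : B) : u + (x + y) + - u = (u + x + - u) + (u + y + - u).
    by rewrite -!baddA baddKl.
  have conjN (u x : B) : u + - x + - u = - (u + x + - u).
    by apply/esym/bneg_eq; rewrite -conjD baddNr badd0r baddNr.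
  split; first by rewrite !badd0r !baddNr.
  by split=> [x y Ex Ey|x Ex]; rewrite ?conjD ?conjN ?Ex ?Ey.
- by move=> _ ->; rewrite !badd0r !baddNr.
- by move=> t; apply: (@baddI _ (- s t)); rewrite -!r2 rij.
Qed.

(** If [x = k g] and [y = l g] act alike, then [z = binv x * y] acts trivially and [w = (l - k) g]
    is additively central. As [blam x z = w], [z] is central too, and it is congruent to [w] modulo
    [F]. *)
Lemma exists_soc_multiple (g : B) : K g -> exists z d,
  [/\ soc z, K z, (0 < d)%N & cong F z (bmuln g d)].
Proof.
move=> Kg; have [k [l [lt_kl El Ec]]] := exists_same_action Kg.
set x := bmuln g k in El Ec; set y := bmuln g l in El Ec.
have Kx : K x by apply: ideal_bmuln.
have Ky : K y by apply: ideal_bmuln.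
pose z := binv x * y; pose w := bmuln g (l - k).
have yE : y = x + w by rewrite /y -(subnKC (ltnW lt_kl)) bmulnD.
have lamz : blam x z = w.
  by apply: (@baddI _ x); rewrite -bmulE /z bmulVKl yE.
have wc b : w + b = b + w.
  have := Ec b; rewrite yE bnegD -!baddA => /baddI.
  move/(congr1 (fun t => t + x)); rewrite -!baddA baddNl !badd0r => E.
  by rewrite {2}E -!baddA baddNl badd0r.
have Kz : K z by apply: idealM => //; apply: idealV.
exists z, (l - k)%N; split=> //; last 2 first.
- by rewrite subn_gt0.
- by apply: (cong_sym idF); rewrite -/w -lamz; apply: (socK Kx).1.
split=> b; first by rewrite blamM -El blamK.
apply: (@blam_inj _ x); rewrite !blamD lamz; exact: wc.
Qed.

(** [N] is generated by [u = e z], with [z] from the previous lemma and [e] an exponent of [F].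
    Modulo [F], [u] is [c g] with [c > 0], so [N] meets [F] trivially and has finite index in
    [K]. *)
Lemma separate_finite_ideal : exists N : B -> Prop, [/\ ideal N,
  forall x, N x -> K x, forall x, N x -> F x -> x = 0 & finite_quot N K].
Proof.
have [g [Kg gen tf]] := cycK.
have [z [d [sz Kz d_gt0 zd]]] := exists_soc_multiple Kg.
have [e e_gt0 eF] := finite_quot_exponent (bzeroset_ideal B) idF finF.
pose u := bmuln z e; have su : soc u by apply: soc_bmuln.
have Ku : K u by apply: ideal_bmuln.
pose c := (d * e)%N; have c_gt0 : (0 < c)%N by rewrite muln_gt0 d_gt0.
have uc : cong F u (bmuln g c) by rewrite /c bmulnM; apply: cong_bmuln.
have idN : ideal (socspan u).
  apply: socspan_ideal => // b.
  (* If [blam b g] is [a g] modulo [F], then [blam b z] is [a z] up to an element of [F], which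
     multiplication by [e] kills. *)
  have [a ga] := gen _ (ideal_blam idK b Kg).
  have [i Fi E] : exists2 i, F i & blam b z = bmulz z a + i.
    apply: congP; apply: (cong_trans idF) (cong_bmulz a idF zd) _.
    rewrite -bmuln_bmulz; apply: (cong_trans idF) (cong_bmuln d idF ga) _.
    have [j Fj ->] := congP (cong_sym idF zd).
    rewrite blamD blam_bmuln /cong baddKl.
    exact: ideal_blam.
  have -> : blam b u = bmulz u a; last exact: socspan_bmulz.
  rewrite /u blam_bmuln E bmuln_centralD ?bmuln_bmulz ?(eF _ Fi) ?badd0r //.
  exact: (socspan_soc sz (socspan_bmulz z a)).2.
exists (socspan u); split=> //.
- by move=> _ [i [j ->]]; apply: idealD => //; [|apply: idealN => //]; apply: ideal_bmuln.
- have lt_case i j : (i < j)%N -> ~ F (- bmuln u i + bmuln u j).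
    move=> lt_ij; rewrite -(subnKC (ltnW lt_ij)) bmulnD baddKl => Fu.
    apply: (tf (c * (j - i))%N); first by rewrite muln_gt0 c_gt0 subn_gt0.
    rewrite bmulnM -cong0; apply: (cong_trans idF) (cong_bmuln _ idF uc).
    by rewrite cong0.
  move=> x [i [j xE]] Fx.
  have E : x = - bmuln u j + bmuln u i by rewrite xE (soc_bmuln i su).2.
  case: (ltngtP i j) => [lt|lt|ij]; last by rewrite xE ij baddNr.
    case: (lt_case i j lt); have := idealN idF Fx; rewrite xE bnegD bnegK.
    by rewrite (soc_bmuln j su).2.
  by case: (lt_case j i lt); rewrite -E.
have [q [h [Fh hP]]] := finite_quotP finF.
apply: (@finite_quotI _ ('I_c * 'I_q)%type (fun t => bmuln g t.1 + h t.2)).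
  by move=> t; apply: idealD => //; [apply: ideal_bmuln|apply: FK].
move=> x Kx.
(* Adding a multiple of [u] turns a negative multiple of [g] into a natural one. *)
have [n [T nT]] : exists n T, cong F (bmuln g n) (x + bmuln u T).
  have [[n|n] gn] := gen x Kx; first by exists n, 0%N; rewrite badd0r.
  exists (c * n.+1 - n.+1)%N, n.+1.
  apply: (cong_trans idF) _ (congD idF gn (cong_sym idF (cong_bmuln n.+1 idF uc))).
  rewrite -bmulnM -{2}(@subnKC n.+1 (c * n.+1)) ?leq_pmull // bmulnD /= baddKl.
  exact: cong_refl.
(* Division of [n] by [c]: modulo [N] there remain a multiple of [g] below [c] and an element of
   [F]. *)
have [f0 Ff0 E] : exists2 f0, F f0 & x + bmuln u T = bmuln u (n %/ c) + bmuln g (n %% c) + f0.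
  apply: congP; apply: (cong_trans idF) _ nT; rewrite {3}(divn_eq n c) bmulnD.
  apply: congD => //; last exact: cong_refl.
  by rewrite mulnC bmulnM; apply: cong_bmuln.
have [t /cong_bzeroset ht] := hP _ Ff0.
exists (Ordinal (ltn_pmod n c_gt0), t) => /=; exists (n %/ c)%N, T; rewrite ht.
have -> : x = bmuln u (n %/ c) + bmuln g (n %% c) + f0 + - bmuln u T by rewrite -E baddK.
rewrite -[bmuln u _ + bmuln g _ + f0]baddA (soc_bmuln _ su).2 -baddA baddKl.
by [].
Qed.
End SeparateFinite.

Lemma fg_add_quot_image (B Q : brace) (I : B -> Prop) (f : B -> Q) :
    quotient_map I f -> fg_add_quot I (@bfull B) ->
  fg_add_quot (@bzeroset Q) (@bfull Q).
Proof.
move=> fq [m [s sP]]; exists m, (fun i => f (s i)) => H [H0 [HD HN]] _ Hs q _.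
have [x <-] := qm_surj fq q.
apply: (sP (fun x => H (f x))) => //.
  split; first by rewrite (qm0 fq).
  by split=> [y z Hy Hz|y Hy]; rewrite ?(qmD fq) ?(qmN fq); [apply: HD|apply: HN].
by move=> y /(qm_ker fq) ->.
Qed.

Lemma separate_finite_quotient (B : brace) (I F K : B -> Prop) :
    ideal I -> ideal F -> ideal K -> (forall x, I x -> F x) -> (forall x, F x -> K x) ->
    finite_quot I F -> infcyclic_quot F K -> soc_quot F K ->
    fg_add_quot I (@bfull B) ->
  exists N : B -> Prop, [/\ ideal N, forall x, I x -> N x,
    forall x, N x -> K x, forall x, N x -> F x -> I x & finite_quot N K].
Proof.
move=> idI idF idK IF FK; have [Q [f fq]] := exists_quotient idI.
have IK x : I x -> K x by move=> /IF/FK.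
rewrite -(preim_image fq idF IF) -(preim_image fq idK IK) -{1}(preim_zero fq).
move=> /(finite_quot_preim fq) fin /(infcyclic_quot_preim fq) cyc /(soc_quot_preim fq) sq fg.
have idfF := ideal_image fq idF; have idfK := ideal_image fq idK.
have FKf q : image f F q -> image f K q by move=> [x /FK]; exists x.
have [N [idN NK NF finN]] :=
  separate_finite_ideal idfF idfK FKf fin cyc sq (fg_add_quot_image fq fg).
exists (preim f N); split.
- exact: ideal_preim fq _ idN.
- by move=> x /(qm_ker fq) Ix; rewrite /preim Ix; apply: ideal0.
- by move=> x; apply: NK.
- by move=> x Nx Fx; apply/(qm_ker fq)/NF.
- exact/(finite_quot_preim fq).
Qed.

(** Induction along the chain above [F]. Across an infinite cyclic factor [K / J], [I] is replaced
    by an ideal of finite index in [K] that meets [J] inside [I]; across a factor of prime order,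
    [I] is kept and [K / I] is still finite. *)
Theorem residually_finite (B : brace) (I F : B -> Prop) :
    ideal I -> (forall x, I x -> F x) -> finite_quot I F ->
    chain (@ss_step B) F (@bfull B) ->
  exists N : B -> Prop, [/\ ideal N, forall x, I x -> N x,
    finite_quot N (@bfull B) & forall x, N x -> F x -> I x].
Proof.
move=> idI IF fin; move E: (@bfull B) => T ch.
elim: ch I idI IF fin E => [J idJ|J K L idJ JK st ch IH] I idI IJ fin E.
  by exists I; split.
have idK := chain_ideall ch.
case: st => [[cyc sq]|pJK].
  have fg : fg_add_quot I (@bfull B).
    rewrite E.
    apply: fg_add_quot_trans (finite_fg_add_quot fin) _.
    apply: fg_add_quot_trans (chain_fg_add ch).
    by apply: ss_step_fg_add; left.
  have [N [idN IN NK NJ finN]] := separate_finite_quotient idI idJ idK IJ JK fin cyc sq fg.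
  have [M [idM NM finM MK]] := IH N idN NK finN E.
  exists M; split=> // x; first by move=> /IN/NM.
  by move=> Mx Jx; apply: NJ => //; apply: MK => //; apply: JK.
have finK : finite_quot I K.
  apply: (finite_quot_trans idI idJ idK IJ JK fin).
  by have [p [h [_ Kh _ hP]]] := pJK; exists p, h.
have [M [idM IM finM MK]] := IH I idI (fun x Ix => JK _ (IJ x Ix)) finK E.
by exists M; split=> // x Mx Jx; apply: MK => //; apply: JK.
Qed.

Definition finite_images_supersoluble (B : brace) :=
  forall I : B -> Prop, ideal I -> finite_quot I (@bfull B) -> supersoluble_quot I.

(** Take [N] of finite index meeting [F] in [I]. Intersected with [F], a supersoluble chain from [N]
    to [B] runs from [I] to [F]. *)
Lemma finite_images_prime_chain (B : brace) (I F : B -> Prop) :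
    finite_images_supersoluble B ->
    ideal I -> ideal F -> (forall x, I x -> F x) -> finite_quot I F ->
    chain (@ss_step B) F (@bfull B) ->
  chain (@prime_order_quot B) I F.
Proof.
move=> good idI idF IF fin ch.
have [N [idN IN finN NF]] := residually_finite idI IF fin ch.
have /supersoluble_quotP chN := good N idN finN.
have -> : I = (fun x => N x /\ F x).
  by apply: set_ext => x; split=> [Ix|[Nx Fx]]; [split; [apply: IN|apply: IF]|apply: NF].
have {2}-> : F = (fun x => bfull x /\ F x) by apply: set_ext => x; split=> [|[]].
apply: chain_cap chN => // x Fx.
by have [n n_gt0 In] := finite_quot_torsion idI idF fin Fx; exists n => //; apply: IN.
Qed.

(** Serves for the finite factors of an almost polycyclic chain and for the finite factors [J / n J]
    of ideals in the socle. *)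
Lemma finite_images_supersoluble_finite (B : brace) (I F : B -> Prop) :
    finite_images_supersoluble B ->
    ideal I -> ideal F -> (forall x, I x -> F x) -> finite_quot I F ->
    supersoluble_quot F ->
  supersoluble_quot I.
Proof.
move=> good idI idF IF fin /supersoluble_quotP ch; apply/supersoluble_quotP.
apply: (chain_trans _ ch); apply: sub_chain (finite_images_prime_chain good idI idF IF fin ch).
by move=> K L _ _; right.
Qed.

Lemma finite_images_supersoluble_quotient (B Q : brace) (I : B -> Prop) (f : B -> Q) :
  quotient_map I f -> finite_images_supersoluble B -> finite_images_supersoluble Q.
Proof.
move=> fq good K idK fin; rewrite -(supersoluble_quot_preim fq) //.
apply: good; first exact: ideal_preim fq _ idK.
by rewrite -(preim_full f); apply/(finite_quot_preim fq).
Qed.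

Local Close Scope brace_scope.

(** * Integer polynomials splitting modulo every prime *)

(** Each complete block of [q] consecutive integers meets [S] exactly [size S] times; the incomplete
    last block is dropped. *)
Lemma sum_mem_modn (q L : nat) (S : seq nat) :
    0 < q -> uniq S -> all (ltn^~ q) S ->
  size S * (L %/ q) <= \sum_(t < L) (t %% q \in S).
Proof.
move=> q_gt0 uS /allP ltS.
have block w : \sum_(t < q * w) (t %% q \in S) = size S * w.
  elim: w => [|w IHw]; first by rewrite !muln0 big_ord0.
  rewrite mulnSr big_split_ord /= IHw mulnSr; congr (_ + _).
  rewrite (eq_bigr (fun i : 'I_q => (nat_of_ord i \in S) : nat)); last first.
    by move=> i _; rewrite mulnC modnMDl modn_small.
  rewrite -(big_mkord xpredT (fun i => (i \in S) : nat)).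
  rewrite -[index_iota 0 q]/(iota 0 (q - 0)) subn0.
  rewrite -big_mkcond /= sum1_count.
  rewrite -size_filter; apply: perm_size; apply: uniq_perm => //.
    by rewrite filter_uniq ?iota_uniq.
  move=> x; rewrite mem_filter mem_iota /= add0n.
  by case: (boolP (x \in S)) => //= /ltS.
have [w [r [-> ->]]] : exists w r, L %/ q = w /\ L = q * w + r.
  by exists (L %/ q), (L %% q); rewrite mulnC -divn_eq.
by rewrite big_split_ord /= block leq_addr.
Qed.

(** Telescoping: the floor at level [k] is at least twice the floor at level [k.+1]. *)
Lemma sum_divn_expn2 (L k N : nat) : \sum_(k.+1 <= i < N) L %/ 2 ^ i <= L %/ 2 ^ k.
Proof.
case: (leqP k.+1 N) => [|ltN]; last by rewrite big_geq // ltnW.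
move=> kN; rewrite -(subnKC kN); move: (N - k.+1) => d {N kN}.
elim: d k => [|d IHd] k; first by rewrite big_geq // addn0.
rewrite big_ltn; last by lia.
rewrite -addSnnS; apply: leq_trans (leq_add (leqnn _) (IHd k.+1)) _.
by rewrite expnSr divnMA; lia.
Qed.

Lemma sum_pfactor_dvd (p x N : nat) :
  prime p -> 0 < x -> \sum_(1 <= i < N) (p ^ i %| x) <= logn p x.
Proof.
move=> p_pr x_gt0.
under eq_bigr do rewrite pfactor_dvdn //.
elim: N => [|N IHN]; first by rewrite big_geq.
case: N IHN => [|N] IHN; first by rewrite big_geq.
rewrite big_nat_recr //=; case: (leqP N.+1 (logn p x)) => h; last by rewrite addn0.
rewrite addn1; apply: leq_ltn_trans h.
apply: (@leq_trans (\sum_(1 <= i < N.+1) 1)).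
  by apply: leq_sum => i _; apply: leq_b1.
by rewrite sum_nat_const_nat muln1 subn1.
Qed.

Lemma dvdn_from_log (a b : nat) :
  0 < a -> 0 < b -> (forall p, prime p -> logn p a <= logn p b) -> a %| b.
Proof.
move=> a_gt0 b_gt0 le; apply/dvdn_partP => // p.
rewrite mem_primes => /andP[p_pr _].
by rewrite p_part pfactor_dvdn // le.
Qed.

(** Compared prime by prime, using Legendre's formula. If [p] does not divide [D], the [n] residue
    classes at each level [i] suffice. If it does, levels up to [k] are covered by the [t] congruent
    to [m], and the higher ones by the power of [D]. *)
Lemma fact_expn_dvd (n L k D m : nat) (G : nat -> nat) :
    (forall t, 0 < G t) -> 0 < D ->
    (forall p i, prime p -> ~~ (p %| D) -> 0 < i ->
      exists S, [/\ size S = n, uniq S, all (ltn^~ (p ^ i)) S &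
        forall t, t %% p ^ i \in S -> p ^ i %| G t]) ->
    (forall p i t, prime p -> p %| D -> 0 < i <= k -> t = m %[mod p ^ i] ->
      p ^ (n * i) %| G t) ->
  L`! ^ n %| (\prod_(t < L) G t) * D ^ (n * (L %/ 2 ^ k)).
Proof.
move=> G_gt0 D_gt0 good bad.
have P_gt0 : 0 < \prod_(t < L) G t by apply: prodn_gt0.
apply: dvdn_from_log => [||p p_pr].
- by rewrite expn_gt0 fact_gt0.
- by rewrite muln_gt0 P_gt0 expn_gt0 D_gt0.
rewrite lognX lognM // ?expn_gt0 ?D_gt0 // lognX logn_fact //.
have logP : logn p (\prod_(t < L) G t) = \sum_(t < L) logn p (G t).
  elim: (L) => [|l IHl]; first by rewrite !big_ord0 logn1.
  by rewrite !big_ord_recr lognM ?prodn_gt0 // IHl.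
rewrite logP {logP}.
case: (boolP (p %| D)) => pD; last first.
  apply: leq_trans (leq_addr _ _).
  apply: (@leq_trans (\sum_(t < L) \sum_(1 <= i < L.+1) (p ^ i %| G t))); last first.
    by apply: leq_sum => t _; apply: sum_pfactor_dvd.
  rewrite exchange_big big_distrr /=.
  rewrite !big_nat; apply: leq_sum => i /andP[i_gt0 _].
  have [S [<- uS ltS SG]] := good p i p_pr pD i_gt0.
  have q_gt0 : 0 < p ^ i by rewrite expn_gt0 prime_gt0.
  apply: leq_trans (sum_mem_modn L q_gt0 uS ltS) _.
  by apply: leq_sum => t _; case: (boolP (_ \in S)) => // /SG ->.
have p_gt1 := prime_gt1 p_pr.
have logD : 0 < logn p D by rewrite logn_gt0 mem_primes p_pr D_gt0.
have tail : \sum_(k.+1 <= i < L.+1) L %/ p ^ i <= L %/ 2 ^ k.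
  apply: leq_trans (sum_divn_expn2 L k L.+1).
  apply: leq_sum => i _; apply: leq_div2l; rewrite ?expn_gt0 //.
  by case: i => // i; rewrite leq_exp2r.
have head : n * \sum_(1 <= i < k.+1) L %/ p ^ i <= \sum_(t < L) logn p (G t).
  apply: (@leq_trans (\sum_(t < L) n * \sum_(1 <= i < k.+1) (t %% p ^ i == m %% p ^ i))).
    rewrite -big_distrr leq_mul2l /= exchange_big /=; apply/orP; right.
    apply: leq_sum => i _.
    have q_gt0 : 0 < p ^ i by rewrite expn_gt0 prime_gt0.
    have := @sum_mem_modn (p ^ i) L [:: m %% p ^ i] q_gt0 isT.
    rewrite /= ltn_mod q_gt0 mul1n => /(_ isT) /leq_trans; apply.
    by apply: leq_sum => t _; rewrite inE.
  apply: leq_sum => t _.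
  (* The last level up to [k] at which [t] and [m] agree bounds the number of levels of
     agreement. *)
  have [i /andP[ik le_i] ti] : exists2 i,
      (i <= k) && (\sum_(1 <= i < k.+1) (t %% p ^ i == m %% p ^ i) <= i) &
      0 < i -> t %% p ^ i == m %% p ^ i.
    elim: (k) => [|k' [i /andP[ik le_i] ti]]; first by exists 0; rewrite ?big_geq.
    rewrite big_nat_recr //=; case: (boolP (t %% p ^ k'.+1 == _)) => tk.
      exists k'.+1 => //; rewrite leqnn addn1 ltnS.
      apply: (@leq_trans (\sum_(1 <= i < k'.+1) 1)).
        by apply: leq_sum => j _; apply: leq_b1.
      by rewrite sum_nat_const_nat muln1 subn1.
    by exists i => //; rewrite addn0 le_i leqW.
  apply: (@leq_trans (n * i)); first by rewrite leq_mul2l le_i orbT.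
  case: (posnP i) => [->|i_gt0]; first by rewrite muln0.
  rewrite -pfactor_dvdn //; apply: bad => //; first by rewrite i_gt0.
  exact/eqP/ti.
(* If [L <= k], all levels of Legendre's sum are already in the head. *)
case: (leqP L k) => [Lk|kL].
  apply: leq_trans (leq_addr _ _); apply: leq_trans head.
  rewrite leq_mul2l; apply/orP; right.
  by rewrite [X in _ <= X](big_cat_nat (n := L.+1)) //= leq_addr.
rewrite (big_cat_nat (n := k.+1)) //=; last by apply: leqW.
rewrite mulnDr; apply: leq_add => //.
apply: (@leq_trans (n * (L %/ 2 ^ k))); first by rewrite leq_mul2l tail orbT.
by rewrite leq_pmulr.
Qed.

(** A weak bound on the central binomial coefficient: passing to [m + 1] multiplies [(2 m)!] by
    [(2 m + 2) (2 m + 1)], which is at least [2 (m + 1) ^ 2]. *)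
Lemma central_fact_ge (m : nat) : 2 ^ m * (m`! * m`!) <= (2 * m).+1`!.
Proof.
apply: (@leq_trans (2 * m)`!); last by rewrite factS leq_pmull.
elim: m => // m IHm.
have -> : 2 * m.+1 = (2 * m).+2 by lia.
rewrite (factS (2 * m).+1) (factS (2 * m)) (factS m) expnS.
apply: (@leq_trans (2 * m.+1 * m.+1 * (2 ^ m * (m`! * m`!)))); first by nia.
by rewrite [X in _ <= X]mulnA; apply: leq_mul IHm; nia.
Qed.

(** The product is [(m + C)! / C!], and the last [C] factors of [(m + C)!] are at most [m + C]. *)
Lemma prod_shift_le (m C : nat) : \prod_(s < m) (s.+1 + C) <= m`! * (m + C) ^ C.
Proof.
have E : C`! * \prod_(s < m) (s.+1 + C) = (m + C)`!.
  elim: m => [|m IHm]; first by rewrite big_ord0 muln1.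
  by rewrite big_ord_recr /= mulnA IHm addSn factS mulnC.
apply: (@leq_trans (m + C)`!); first by rewrite -E leq_pmull ?fact_gt0.
elim: C {E} => [|C IHC]; first by rewrite addn0 muln1.
rewrite addnS factS expnS mulnCA leq_mul2l /=; apply: leq_trans IHC _.
by rewrite leq_mul2l; apply/orP; right; case: C => // C; rewrite leq_exp2r.
Qed.

(** With truncated subtraction, [t - m + (m - t)] is [|t - m|]. The middle index gives [C], and each
    side gives the product bounded by [prod_shift_le]. *)
Lemma prod_dist_le (m C : nat) :
  \prod_(t < (2 * m).+1) (t - m + (m - t) + C)
    <= C * (m`! * m`!) * (m + C) ^ (2 * C).
Proof.
have -> : (2 * m).+1 = m + m.+1 by lia.
rewrite big_split_ord /= big_ord_recl /= addn0 subnn !add0n.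
under [X in _ * (_ * X)]eq_bigr => i _ do
  have -> : m + bump 0 i - m + (m - (m + bump 0 i)) + C = i.+1 + C by rewrite /bump; lia.
have -> : \prod_(i < m) (i - m + (m - i) + C) = \prod_(s < m) (s.+1 + C).
  rewrite (reindex_inj rev_ord_inj) /=; apply: eq_bigr => i _.
  by have := ltn_ord i; lia.
have h := prod_shift_le m C.
apply: (@leq_trans (C * ((m`! * (m + C) ^ C) * (m`! * (m + C) ^ C)))).
  by rewrite mulnCA leq_mul2l leq_mul ?orbT.
by rewrite mul2n -addnn expnD; nia.
Qed.

(** With [t = 2 ^ u] and [m = 2 t], [central_fact_ge] gains [2 ^ (2 t)]. One factor [2 ^ t] pays for
    the power of [D], the other for [C (m + C) ^ (2 C)], which is polynomial in [m]. *)
Lemma fact_beats_prod_dist (D C : nat) : 0 < D -> exists m,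
  D ^ ((2 * m).+1 %/ 2 ^ D.+3) * \prod_(t < (2 * m).+1) (t - m + (m - t) + C)
    < (2 * m).+1`!.
Proof.
move=> D_gt0.
have [u [u_ge u_big]] : exists u, C <= u /\ u + 2 * C * (u + 2) < 2 ^ u.
  exists (C + 8); split; first by lia.
  apply: (@leq_ltn_trans (2 * (C + 8) * (C + 8) + 5 * (C + 8))); first by nia.
  elim: C => // C; rewrite addSn expnS; nia.
set t := 2 ^ u in u_big; exists (2 * t); set m := 2 * t.
have D_exp : D ^ ((2 * m).+1 %/ 2 ^ D.+3) <= 2 ^ t.
  apply: (@leq_trans ((2 ^ D) ^ ((2 * m).+1 %/ 2 ^ D.+3))).
    by case: (_ %/ _) => // e; rewrite leq_exp2r // ltnW // ltn_expl.
  rewrite -expnM leq_exp2l //.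
  (* The reason for the exponent [D.+3]: for [L = 4 t + 1], [D] times the quotient of [L] by
     [8 (D + 1)] is at most [t]. *)
  have h : 8 * D.+1 <= 2 ^ D.+3 by rewrite !expnS; have := ltn_expl D (isT : 1 < 2); lia.
  apply: (@leq_trans (D * ((2 * m).+1 %/ (8 * D.+1)))).
    by rewrite leq_mul2l leq_div2l ?orbT.
  have t_gt0 : 0 < t by rewrite expn_gt0.
  have := leq_divM (2 * m).+1 (8 * D.+1); rewrite /m; nia.
have C_exp : (m + C) ^ (2 * C) <= 2 ^ (2 * C * (u + 2)).
  rewrite [2 * C * _]mulnC [in X in _ <= X]expnM.
  move: (2 * C) => [//|c]; rewrite leq_exp2r //.
  rewrite expnD /m /t; have := ltn_expl u (isT : 1 < 2); lia.
have C_le : C <= 2 ^ u by apply: leq_trans u_ge (ltnW (ltn_expl _ _)).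
apply: leq_ltn_trans (leq_mul D_exp (prod_dist_le m C)) _.
apply: leq_trans (central_fact_ge m).
have F_gt0 : 0 < m`! * m`! by rewrite muln_gt0 fact_gt0.
have -> : 2 ^ t * (C * (m`! * m`!) * (m + C) ^ (2 * C))
  = 2 ^ t * (C * (m + C) ^ (2 * C)) * (m`! * m`!) by nia.
rewrite ltn_pmul2r // /m mul2n -addnn expnD ltn_pmul2l ?expn_gt0 //.
rewrite addnn -mul2n; apply: (leq_ltn_trans (leq_mul C_le C_exp)).
by rewrite -expnD ltn_exp2l.
Qed.

Import Order.TTheory GRing.Theory Num.Theory.
Local Open Scope ring_scope.

Lemma horner_taylor2 (R : comNzRingType) (f : {poly R}) (a h : R) :
  exists q, f.[a + h] = f.[a] + f^`().[a] * h + q * h ^+ 2.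
Proof.
have le : (size f <= (size f).+2)%N by rewrite ltnW // ltnW.
exists (\sum_(i < size f) f^`N(i.+2).[a] * h ^+ i).
rewrite (nderiv_taylor_wide (mulrC a h) le) 2!big_ord_recl /=.
rewrite nderivn0 nderivn1 expr0 mulr1 expr1 -addrA; congr (_ + (_ + _)).
by rewrite mulr_suml; apply: eq_bigr => i _; rewrite -mulrA -exprD addn2.
Qed.

Lemma dvdz_horner_sub (f : {poly int}) (x y : int) : (x - y %| f.[x] - f.[y])%Z.
Proof.
have /factor_theorem[q E] : root (f - f.[y]%:P) y.
  by rewrite rootE !hornerE subrr.
have -> : f.[x] - f.[y] = (f - f.[y]%:P).[x] by rewrite !hornerE.
by rewrite E hornerM hornerXsubC dvdz_mull.
Qed.

Lemma leq_ord_pred (m : nat) (a : 'I_m) : (a <= m.-1)%N.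
Proof. by rewrite -ltnS (ltn_predK (ltn_ord a)). Qed.

(** * Hensel's lemma *)

Section Hensel.
Variables (p : nat) (f : {poly int}).
Hypothesis p_pr : prime p.

Lemma dvdz_Fp (z : int) : (p %| z)%Z = (z%:~R == 0 :> 'F_p).
Proof. by rewrite (dvdz_pcharf (pchar_Fp p_pr)). Qed.

Lemma Fp_lift (x : 'F_p) : exists z : int, z%:~R = x.
Proof. by exists (Posz (val x)); rewrite -pmulrn natr_Zp. Qed.

Lemma hensel (x : 'F_p) (i : nat) :
    root (map_poly intr f) x -> ~~ root (map_poly intr f)^`() x -> (0 < i)%N ->
  exists a : int, a%:~R = x /\ ((p ^ i)%N %| f.[a])%Z.
Proof.
move=> fx dfx; case: i => // i _; elim: i => [|i [a [ax /dvdzP[c fa]]]].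
  have [a ax] := Fp_lift x; exists a; split=> //.
  by rewrite expn1 dvdz_Fp -horner_map /= ax -rootE.
(* Newton step: with [f(a) = c p ^ (i + 1)], the correction [t] solves [c + f'(a) t = 0] modulo [p];
   the quadratic remainder is divisible by [p ^ (2 i + 2)]. *)
have [t tE] : exists t : int, t%:~R = - (c%:~R / (f^`().[a])%:~R) :> 'F_p by apply: Fp_lift.
have [q E] := horner_taylor2 f a ((p ^ i.+1)%N%:Z * t).
exists (a + (p ^ i.+1)%N%:Z * t); split.
  rewrite rmorphD rmorphM /= ax expnS PoszM rmorphM /=.
  by rewrite -[p%:~R]pmulrn pchar_Fp_0 // !mul0r addr0.
have : (p %| c + f^`().[a] * t)%Z.
  rewrite dvdz_Fp rmorphD rmorphM /= tE mulrN mulrCA divff ?mulr1 ?subrr //.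
  by move: dfx; rewrite rootE deriv_map -ax horner_map.
case/dvdzP => d dE; rewrite E fa.
apply/dvdzP; exists (d + q * t ^+ 2 * (p ^ i)%N%:Z).
have -> : (p ^ i.+2)%N%:Z = (p ^ i.+1)%N%:Z * p%:Z by rewrite expnSr PoszM.
have -> : c * (p ^ i.+1)%N%:Z + f^`().[a] * ((p ^ i.+1)%N%:Z * t)
  = (c + f^`().[a] * t) * (p ^ i.+1)%N%:Z by ring.
by rewrite dE expnSr PoszM; ring.
Qed.
End Hensel.

(** * Homogenized values of an integer polynomial *)

Section Homogenization.
Variables (f : {poly int}) (M : int).
Local Notation n := (size f).-1.
(* The value at [j] is [M ^ n * f(j / M)], without division. *)
Definition scale_poly : {poly int} := \poly_(a < size f) (f`_a * M ^+ (n - a)).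
Local Notation g := scale_poly.

Lemma horner_scale_poly (x : int) : g.[M * x] = M ^+ n * f.[x].
Proof.
rewrite horner_poly horner_coef mulr_sumr; apply: eq_bigr => a _.
rewrite exprMn -[in RHS](@subnK a n) ?exprD; first by ring.
exact: leq_ord_pred.
Qed.

(** A zero would make [j / M] a rational root of [f], hence give a linear factor. *)
Lemma scale_poly_neq0 (j : int) :
  irreducible_poly f -> (2 < size f)%N -> M != 0 -> g.[j] != 0.
Proof.
move=> /irreducible_rat_int f_irr f_gt2 M0; apply/eqP => gj.
have MQ0 : M%:~R != 0 :> rat by rewrite intr_eq0.
suff : root (map_poly intr f) (j%:~R / M%:~R : rat).
  rewrite -dvdp_XsubCl => /f_irr.2; rewrite size_XsubC => /(_ isT)/eqp_size.
  rewrite size_XsubC size_map_inj_poly ?rmorph0 //; last exact: intr_inj.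
  by move=> E; rewrite -E in f_gt2.
suff /eqP : M%:~R ^+ n * (map_poly intr f).[j%:~R / M%:~R] = 0 :> rat.
  by rewrite mulf_eq0 expf_eq0 (negPf MQ0) andbF.
rewrite -[RHS](rmorph0 (intmul (1 : rat))) -gj /= [in RHS]horner_poly horner_coef.
rewrite size_map_inj_poly ?rmorph0 //; last exact: intr_inj.
rewrite mulr_sumr rmorph_sum /=; apply: eq_bigr => a _.
rewrite coef_map /= !rmorphM !rmorphXn /= expr_div_n.
rewrite -[in M%:~R ^+ n](@subnK a n) ?exprD; last exact: leq_ord_pred.
by field; rewrite expf_neq0.
Qed.

(** Besides its coefficient, each term of [g(j)] carries exactly [n] factors equal to [M] or [j]. *)
Lemma scale_poly_dvd (d j : int) : (d %| M)%Z -> (d %| j)%Z -> (d ^+ n %| g.[j])%Z.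
Proof.
move=> dM dj; rewrite horner_poly; apply: rpred_sum => a _.
have -> : d ^+ n = d ^+ (n - a) * d ^+ a by rewrite -exprD subnK ?leq_ord_pred.
by apply: dvdz_mul; rewrite ?dvdz_mull // dvdz_exp2r.
Qed.

(** Termwise comparison with the binomial expansion: below the top degree, a coefficient is at most
    [A], hence at most [A ^ (n - a)], and the top one is a unit. *)
Lemma scale_poly_le (j : int) : `|lead_coef f|%N = 1%N -> M != 0 ->
  (`|g.[j]| <= (`|j| + `|M| * \sum_(a < size f) `|(f`_a)%R|) ^ n)%N.
Proof.
set A := (\sum_(a < size f) _)%N => lead1 M0.
have f_gt0 : (0 < size f)%N by rewrite size_poly_gt0 -lead_coef_eq0 -absz_eq0 lead1.
rewrite horner_poly addnC expnDn (ltn_predK f_gt0).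
have tri (I : finType) (F : I -> int) : (`|(\sum_i F i)%R| <= \sum_i `|F i|)%N.
  elim/big_rec2: _ => [|i x y _ le]; first by [].
  apply: (@leq_trans (`|F i| + `|x|)%N); last by rewrite leq_add2l.
  by have := ler_normD (F i) x; rewrite -!abszE -PoszD lez_nat.
apply: leq_trans (tri _ _) _; apply: leq_sum => a _.
rewrite !abszM !abszX mulnA; apply: leq_mul => //.
have a_le : (a <= n)%N by exact: leq_ord_pred.
apply: leq_trans (leq_pmull _ _); last by rewrite bin_gt0.
have [an|a_ne] := eqVneq (a : nat) n.
  by rewrite an subnn !expn0 muln1 -/(lead_coef f) lead1.
have fa_le b : (`|(f`_b)%R| <= A)%N.
  case: (ltnP b (size f)) => hb; last by rewrite nth_default.
  by rewrite /A (bigD1 (Ordinal hb)) //= leq_addr.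
have A_gt0 : (0 < A)%N by have := fa_le n; rewrite -/(lead_coef f) lead1.
rewrite expnMn mulnC leq_mul2l; apply/orP; right.
apply: leq_trans (fa_le a) _; rewrite -[X in (X <= _)%N]expn1.
by apply: leq_pexp2l => //; lia.
Qed.
End Homogenization.

(** * The splitting criterion *)

Lemma separable_mod (p : nat) (f u v : {poly int}) (D : int) :
    prime p -> D%:P = u * f + v * f^`() -> ~~ (p %| D)%Z ->
  separable_poly (map_poly intr f : {poly 'F_p}).
Proof.
move=> p_pr E pD; rewrite unlock; apply/Bezout_coprimepP.
exists (map_poly intr u, map_poly intr v) => /=.
rewrite deriv_map -!rmorphM -rmorphD -E /= map_polyC /= polyC_eqp1.
by rewrite -(dvdz_Fp p_pr).
Qed.

Lemma lead1_size_map_Fp (p : nat) (f : {poly int}) :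
  prime p -> `|lead_coef f|%N = 1%N ->
  size (map_poly intr f : {poly 'F_p}) = size f.
Proof.
move=> p_pr lead1; apply: size_map_poly_id0.
by rewrite -(dvdz_Fp p_pr) dvdzE /= lead1 dvdn1 neq_ltn prime_gt1 ?orbT.
Qed.

(** [D] is the resultant of [f] and its derivative; it is nonzero because an irreducible [f] is
    coprime to a nonzero polynomial of smaller degree. *)
Lemma irreducible_discriminant (f : {poly int}) :
    irreducible_poly f -> (2 < size f)%N ->
  exists D u v, D != 0 /\ D%:P = u * f + v * f^`().
Proof.
move=> f_irr f_gt2.
have f_neq0 : f != 0 by rewrite -size_poly_gt0 (ltn_trans _ f_gt2).
have f_gt1 : (1 < size f)%N by apply: ltnW.
have f'_gt1 : (1 < size f^`())%N.
  have [n sf] : exists n, size f = n.+3.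
    by case: (size f) f_gt2 => [|[|[|n]]] // _; exists n.
  rewrite ltnNge; apply/negP => le.
  have : f^`()`_n.+1 = 0 by apply: nth_default; apply: leq_trans le _.
  have : lead_coef f != 0 by rewrite lead_coef_eq0.
  by rewrite coef_deriv lead_coefE sf /= => /negPf f0 /eqP; rewrite mulrn_eq0 f0.
have [[u v] _ E] := resultant_in_ideal f_gt1 f'_gt1.
exists (resultant f f^`()), u, v; split=> //.
rewrite resultant_eq0 -leqNgt.
have : coprimep f f^`().
  rewrite irreducible_poly_coprime //; apply/negP => /dvdp_leq.
  by rewrite -size_poly_gt0 ltnW // leqNgt lt_size_deriv // => /(_ isT).
by rewrite /coprimep => /eqP ->.
Qed.

(** Putting the implication inside the sigma type makes the lift a total function of [x], with
    arbitrary values off the roots. *)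
Lemma seq_lift_Fp (p i : nat) (f : {poly int}) :
    prime p -> separable_poly (map_poly intr f : {poly 'F_p}) -> (0 < i)%N ->
  forall x : 'F_p, {a : int | root (map_poly intr f) x ==>
    (a%:~R == x) && ((p ^ i)%N %| f.[a])%Z}.
Proof.
move=> p_pr sep i_gt0 x; apply: sigW.
case: (boolP (root _ x)) => fx /=; last by exists 0.
have [|a [/eqP ax fa]] := hensel p_pr fx _ i_gt0; last by exists a; rewrite ax.
by rewrite rootE; apply: coprimep_root fx; move: sep; rewrite unlock.
Qed.

Theorem irreducible_split_mod_primes (f : {poly int}) :
    irreducible_poly f -> `|lead_coef f|%N = 1%N ->
    (forall p, prime p ->
       exists s : seq 'F_p, map_poly intr f %= \prod_(a <- s) ('X - a%:P)) ->
  size f = 2.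
Proof.
move=> f_irr lead1 split_p.
have f_gt1 := f_irr.1.
case: (ltnP 2 (size f)) => [f_gt2|f_le2]; last by apply/eqP; rewrite eqn_leq f_le2.
have [D0 [u [v [D0_neq0 DE]]]] := irreducible_discriminant f_irr f_gt2.
set D := `|D0|%N; have D_gt0 : (0 < D)%N by rewrite absz_gt0.
(* [k] is the exponent in [fact_beats_prod_dist]; [M = D ^ k] is divisible by [p ^ i] whenever [p]
   divides [D] and [i <= k]. *)
set n := (size f).-1; set k := D.+3; set M : int := (D ^ k)%N%:Z.
have M0 : M != 0 by rewrite /M -absz_eq0 /= -lt0n expn_gt0 D_gt0.
set C := (`|M| * \sum_(a < size f) `|(f`_a)%R|)%N.
have [m] := fact_beats_prod_dist C D_gt0; rewrite ltnNge => /negP; case.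
set L := (2 * m).+1.
pose G (t : nat) : nat := `|(scale_poly f M).[t%:Z - m%:Z]|%N.
have G_gt0 t : (0 < G t)%N by rewrite absz_gt0 scale_poly_neq0.
have n_gt0 : (0 < n)%N by rewrite /n -ltnS (ltn_predK f_gt1).
(* Divisibility bounds [L! ^ n] above; taking [n]-th roots contradicts the choice of [m]. *)
suff div : (L`! ^ n %| (\prod_(t < L) G t) * D ^ (n * (L %/ 2 ^ k)))%N.
  rewrite -(@leq_exp2r _ _ n) //.
  apply: leq_trans (dvdn_leq _ div) _.
    by rewrite muln_gt0 expn_gt0 D_gt0 prodn_gt0.
  rewrite mulnC expnMn -expnM [(n * _)%N]mulnC leq_mul2l; apply/orP; right.
  rewrite (big_morph (fun x => x ^ n)%N (fun x y => expnMn x y n) (exp1n n)).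
  apply: leq_prod => t _; apply: leq_trans (scale_poly_le _ lead1 M0) _.
  rewrite -/n -/C; have -> // : `|t%:Z - m%:Z|%N = (t - m + (m - t))%N by lia.
apply: (@fact_expn_dvd n L k D m G) => //.
- move=> p i p_pr pD i_gt0.
  have pD0 : ~~ (p %| D0)%Z by rewrite dvdzE.
  have sep := separable_mod p_pr DE pD0.
  have [s fs] := split_p p p_pr.
  have us : uniq s by rewrite -separable_prod_XsubC -(eqp_separable fs).
  have szs : size s = n.
    by have := eqp_size fs; rewrite size_prod_XsubC lead1_size_map_Fp // /n => ->.
  have [a aP] : exists a : 'F_p -> int, forall x, x \in s ->
      (a x)%:~R = x /\ ((p ^ i)%N %| f.[a x])%Z.
    exists (fun x => sval (seq_lift_Fp p_pr sep i_gt0 x)) => x xs.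
    case: (seq_lift_Fp _ _ _ x) => a /= /implyP.
    rewrite (eqp_root fs) root_prod_XsubC => /(_ xs)/andP[/eqP]; by split.
  pose q := (p ^ i)%N; have q_gt0 : (0 < q)%N by rewrite expn_gt0 prime_gt0.
  (* [t] lies in the class [r x] when [t - m] is [M (a x)] modulo [p ^ i], where [g] takes the value
     [M ^ n * f(a x)]. *)
  pose r x : nat := `|((M * a x + m%:Z)%R %% q)%Z|%N.
  have rE x : (r x)%:Z = ((M * a x + m%:Z)%R %% q)%Z.
    by rewrite /r gez0_abs // modz_ge0 // lt0n_neq0.
  exists (map r s); split; first by rewrite size_map.
  (* [M] is invertible modulo [p], and lifts of distinct roots differ modulo [p]. *)
  + rewrite map_inj_in_uniq // => x y xs ys rxy.
    have : (p %| (M * a x + m%:Z) - (M * a y + m%:Z))%Z.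
      apply: (@dvdz_trans q); first by rewrite dvdzE /= dvdn_exp.
      by rewrite -eqz_mod_dvd -!rE rxy.
    rewrite (_ : _ - _ = M * (a x - a y)); last by ring.
    rewrite Gauss_dvdzr; last first.
      rewrite coprimezE /= coprimeXr // prime_coprime //.
    rewrite (dvdz_Fp p_pr) rmorphB /= (aP x xs).1 (aP y ys).1 subr_eq0.
    by move/eqP.
  + apply/allP => _ /mapP[x _ ->] /=; rewrite -ltz_nat rE ltz_pmod //.
  + move=> t /mapP[x xs E].
    have tE : (t%:Z = (M * a x + m%:Z)%R %[mod q])%Z.
      by rewrite -rE -E modz_nat.
    have : (q %| t%:Z - m%:Z - M * a x)%Z.
      by rewrite -addrA -opprD [m%:Z + _]addrC -eqz_mod_dvd; apply/eqP.
    move/dvdz_trans => /(_ _ (dvdz_horner_sub (scale_poly f M) _ _)).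
    rewrite horner_scale_poly => h.
    by have := rpredD h (dvdz_mull (M ^+ n) (aP x xs).2); rewrite subrK.
- move=> p i t p_pr pD /andP[i_gt0 ik] tm.
  have : (((p ^ i)%N%:Z) ^+ n %| (scale_poly f M).[t%:Z - m%:Z])%Z.
    apply: scale_poly_dvd.
      rewrite dvdzE /= (dvdn_trans (dvdn_exp2l p ik)) // dvdn_exp2r //.
    by rewrite -eqz_mod_dvd !modz_nat tm.
  by rewrite dvdzE abszX /= -expnM mulnC.
Qed.

(** * Integer matrices triangularizable modulo every prime *)

Lemma exists_irreducible_factor (F : fieldType) (p : {poly F}) :
  (1 < size p)%N -> exists2 d, irreducible_poly d & d %| p.
Proof.
have [n] := ubnP (size p); elim: n p => // n IHn p; rewrite ltnS => le_n p_gt1.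
have [irr|nirr] := pselect (irreducible_poly p); first by exists p.
have [q [q_neq1 qp nqp]] : exists q : {poly F}, [/\ size q != 1%N, q %| p & ~~ (q %= p)].
  apply: contrapT => no; apply: nirr; split=> // q q1 qp.
  by apply: contrapT => /negP nqp; apply: no; exists q.
have p_neq0 : p != 0 by rewrite -size_poly_gt0 ltnW.
have q_gt1 : (1 < size q)%N.
  rewrite ltn_neqAle eq_sym q_neq1 size_poly_gt0.
  by apply: contraTneq qp => ->; rewrite dvd0p.
have q_lt : (size q < size p)%N.
  by rewrite ltn_neqAle dvdp_leq // dvdp_size_eqp // nqp.
have [|d irr dq] := IHn q _ q_gt1; first exact: leq_trans le_n.
by exists d => //; apply: dvdp_trans qp.
Qed.

Definition splits_mod_primes (f : {poly int}) :=
  forall p, prime p ->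
    exists s : seq 'F_p, map_poly intr f %= \prod_(a <- s) ('X - a%:P).

Lemma splits_mod_primes_factor (f h : {poly int}) :
  splits_mod_primes (f * h) -> splits_mod_primes f.
Proof.
move=> sf p p_pr; have [s] := sf p p_pr; rewrite rmorphM /= => /eqp_dvdr E.
have : map_poly intr f %| \prod_(a <- s) ('X - a%:P) by rewrite -E dvdp_mulIl.
by move=> /dvdp_prod_XsubC[m]; exists (mask m s).
Qed.

(** By Gauss's lemma, an irreducible rational factor can be taken integral. Its leading coefficient
    divides [1], so the criterion shows that it is linear. *)
Lemma splits_mod_primes_root (f : {poly int}) :
  f \is monic -> splits_mod_primes f -> (1 < size f)%N -> exists b, root f b.
Proof.
move=> f_mon sf f_gt1.
have [|d d_irr] := @exists_irreducible_factor _ (map_poly intr f : {poly rat}).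
  by rewrite size_map_inj_poly ?rmorph0 //; apply: intr_inj.
move=> /dvdpP_rat_int[d1 [a a_neq0 dE] [h fE]].
have lead_d1 : `|lead_coef d1|%N = 1%N.
  have /eqP := congr1 lead_coef fE.
  rewrite (monicP f_mon) lead_coefM => /eqP/(congr1 absz)/eqP.
  by rewrite abszM eq_sym muln_eq1 => /andP[/eqP].
have d1_irr : irreducible_poly d1.
  apply/irreducible_rat_int; split; first by move: d_irr.1; rewrite dE size_scale.
  move=> q q1 qd; have qd' : q %| d by rewrite dE dvdpZr.
  apply: (@eqp_trans _ d); first exact: d_irr.2.
  by rewrite dE eqp_scale.
have d1_size : size d1 = 2.
  apply: irreducible_split_mod_primes => //.
  by apply: (@splits_mod_primes_factor _ h); rewrite -fE.
(* The leading coefficient is [1] or [-1], hence its own inverse. *)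
exists (- (lead_coef d1 * d1`_0)); rewrite fE rootM; apply/orP; left.
rewrite rootE horner_coef d1_size !big_ord_recl big_ord0 /= addr0 expr0 expr1 mulr1.
have : (lead_coef d1) ^+ 2 = 1 by case: (lead_coef d1) lead_d1 => [[|[|k]]|[|k]].
rewrite lead_coefE d1_size /= => E.
by rewrite mulrN mulrA -expr2 E mul1r subrr.
Qed.

Lemma splits_of_splits_mod_primes (f : {poly int}) :
  f \is monic -> splits_mod_primes f -> exists s, f = \prod_(b <- s) ('X - b%:P).
Proof.
have [n] := ubnP (size f); elim: n f => // n IHn f; rewrite ltnS => le_n f_mon sf.
case: (leqP (size f) 1) => [f_le1|f_gt1].
  exists [::]; rewrite big_nil [f]size1_polyC //; move: f_mon.
  by rewrite [f]size1_polyC // monicE lead_coefC coefC => /eqP ->.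
have [b /factor_theorem[q fE]] := splits_mod_primes_root f_mon sf f_gt1.
have q_mon : q \is monic by rewrite -(monicMr q (monicXsubC b)) -fE.
have [||s qE] := IHn q _ q_mon.
- apply: leq_trans le_n; rewrite fE size_Mmonic ?monicXsubC ?monic_neq0 //.
  by rewrite size_XsubC addn2.
- by apply: (@splits_mod_primes_factor _ ('X - b%:P)); rewrite -fE.
by exists (b :: s); rewrite big_cons fE qE mulrC.
Qed.

Lemma char_poly_conj (R : comUnitRingType) (r : nat) (P A : 'M[R]_r) :
  P \in unitmx -> char_poly (P *m A *m invmx P) = char_poly A.
Proof.
move=> P_unit; rewrite /char_poly.
have -> : char_poly_mx (P *m A *m invmx P)
    = map_mx polyC P *m char_poly_mx A *m map_mx polyC (invmx P).
  rewrite /char_poly_mx mulmxBr mulmxBl !map_mxM /=; congr (_ - _).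
  by rewrite scalar_mxC -mulmxA -map_mxM mulmxV //= map_mx1 mulmx1.
rewrite !det_mulmx mulrAC -det_mulmx -map_mxM mulmxV //= map_mx1 det1 mul1r.
by [].
Qed.

Lemma char_poly_splits (r : nat) (g : 'M[int]_r) :
    (forall p, prime p -> exists2 P : 'M['F_p]_r, P \in unitmx &
       is_trig_mx (P *m map_mx intr g *m invmx P)) ->
  exists s, char_poly g = \prod_(b <- s) ('X - b%:P).
Proof.
move=> trig; apply: splits_of_splits_mod_primes; first exact: char_poly_monic.
move=> p p_pr; have [P P_unit tr] := trig p p_pr.
exists [seq (P *m map_mx intr g *m invmx P) i i | i <- enum 'I_r].
rewrite map_char_poly -(char_poly_conj _ P_unit) (char_poly_trig tr).
by rewrite big_map big_enum eqpxx.
Qed.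

Lemma trig_mulmx (R : nzRingType) (r : nat) (A B : 'M[R]_r) (i j : 'I_r) :
  is_trig_mx A -> is_trig_mx B -> (i <= j)%N ->
  (A *m B) i j = (A i i * B i i) *+ (i == j).
Proof.
move=> /is_trig_mxP trA /is_trig_mxP trB ij; rewrite mxE.
rewrite (bigD1 i) //= big1 ?addr0 => [|k ki].
  have [<-|ne] := eqVneq i j; first by [].
  by rewrite trB ?mulr0 // ltn_neqAle ij andbT.
have [lt|ge] := ltnP i k; first by rewrite trA ?mul0r.
by rewrite (trB k j) ?mulr0 // (leq_trans _ ij) // ltn_neqAle ge andbT.
Qed.

(** [is_trig_mx] means lower triangular. [A B] and [B A] have the same diagonal, so the bracket is
    strictly lower triangular. *)
Lemma trig_bracket (R : comNzRingType) (r : nat) (A B : 'M[R]_r) (i j : 'I_r) :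
  is_trig_mx A -> is_trig_mx B -> (i <= j)%N -> (A *m B - B *m A) i j = 0.
Proof.
move=> trA trB ij.
have -> : (A *m B - B *m A) i j = (A *m B) i j - (B *m A) i j by rewrite !mxE.
by rewrite !trig_mulmx // mulrC subrr.
Qed.

Lemma all_primes_dvd_eq0 (z : int) : (forall p, prime p -> (p %| z)%Z) -> z = 0.
Proof.
move=> dv; apply: contrapT => /eqP z0.
have [p p_gt p_pr] := prime_above `|z|%N.
have := dv p p_pr; rewrite dvdzE => /dvdn_leq; rewrite absz_gt0 z0 => /(_ isT).
by rewrite leqNgt p_gt.
Qed.

Definition triangularizes (p r : nat) (G : 'M[int]_r -> Prop) (P : 'M['F_p]_r) :=
  P \in unitmx /\
  forall g, G g -> is_trig_mx (P *m map_mx intr g *m invmx P).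

(** Otherwise a nonzero vector can be multiplied [r] times by brackets without becoming zero. Modulo
    each [p] such a product of strictly triangular matrices vanishes, so the vector is divisible by
    every prime. *)
Lemma exists_bracket_killed (r : nat) (G : 'M[int]_r -> Prop) :
    (0 < r)%N ->
    (forall p, prime p -> exists P : 'M['F_p]_r, triangularizes G P) ->
  exists2 v : 'rV[int]_r, v != 0 &
    forall g h, G g -> G h -> v *m (g *m h - h *m g) = 0.
Proof.
move=> r_gt0 trig; apply: contrapT => no.
have step (v : 'rV[int]_r) : v != 0 ->
    exists g h, [/\ G g, G h & v *m (g *m h - h *m g) != 0].
  move=> v0; apply: contrapT => all0; apply: no; exists v => // g h Gg Gh.
  by apply: contrapT => /eqP n0; apply: all0; exists g, h.
(* In the coordinates given by [P], the last [k] entries vanish. The brackets are chosen over the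
   integers, hence independently of [p]. *)
have iter k : exists2 v : 'rV[int]_r, v != 0 &
    forall p (P : 'M['F_p]_r), prime p -> triangularizes G P ->
    forall j : 'I_r, (r <= j + k)%N -> (map_mx intr v *m invmx P) 0 j = 0.
  elim: k => [|k [v v0 vP]].
    exists (const_mx 1) => [|p P _ _ j]; last by rewrite addn0 leqNgt ltn_ord.
    by apply/eqP => /matrixP/(_ 0 (Ordinal r_gt0)); rewrite !mxE.
  have [g [h [Gg Gh n0]]] := step v v0.
  exists (v *m (g *m h - h *m g)) => // p P p_pr tP j jk.
  have [P_unit tr] := tP.
  have -> : map_mx intr (v *m (g *m h - h *m g)) *m invmx P =
      (map_mx intr v *m invmx P) *m
      (P *m map_mx intr g *m invmx P *m (P *m map_mx intr h *m invmx P)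
       - P *m map_mx intr h *m invmx P *m (P *m map_mx intr g *m invmx P)).
    rewrite map_mxM map_mxB !map_mxM mulmxBr !mulmxA mulmxBr !mulmxA.
    by rewrite !mulmxKV // mulmxBl.
  rewrite mxE big1 // => i _; have [ij|ji] := leqP i j.
    by rewrite trig_bracket ?mulr0 //; apply: tr.
  by rewrite (vP p) ?mul0r // (leq_trans jk) // addnS -addSn leq_add2r.
have [v v0 vP] := iter r.
case/eqP: v0; apply/rowP => j; rewrite mxE; apply: all_primes_dvd_eq0 => p p_pr.
have [P tP] := trig p p_pr.
have : map_mx intr v *m invmx P = 0.
  by apply/rowP => k; rewrite (vP p) ?mxE ?leq_addl.
move/(congr1 (mulmx^~ P)); rewrite mulmxKV ?tP.1 // mul0mx => /rowP/(_ j).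
by rewrite !mxE (dvdz_Fp p_pr) => ->.
Qed.

(** Factors are peeled off one at a time: either [g - b] kills [U], or its image of [U] is a nonzero
    stable subspace of [U] killed by the remaining product. *)
Lemma stable_eigenvector (F : fieldType) (n : nat) (g U : 'M[F]_n.+1) (s : seq F) :
    U != 0 -> (U *m g <= U)%MS -> U *m \prod_(b <- s) (g - b%:M) = 0 ->
  exists2 b, b \in s & (U :&: eigenspace g b)%MS != 0.
Proof.
elim: s U => [|b s IHs] U U0 Ug.
  by rewrite big_nil mulmx1 => /eqP; rewrite (negPf U0).
rewrite big_cons -mulmxE mulmxA.
have [E _|n0 Us] := eqVneq (U *m (g - b%:M)) 0.
  exists b; rewrite ?mem_head //.
  have Ub : (U <= eigenspace g b)%MS.
    by apply/eigenspaceP/eqP; rewrite -subr_eq0 -mul_mx_scalar -mulmxBr E.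
  have : (U <= U :&: eigenspace g b)%MS by rewrite sub_capmx submx_refl.
  by apply: contraTneq => ->; rewrite submx0.
have sub : (U *m (g - b%:M) <= U)%MS.
  by rewrite mulmxBr addmx_sub // mul_mx_scalar -scaleNr scalemx_sub.
have [|b' b's n0'] := IHs _ n0 _ Us.
  have -> : U *m (g - b%:M) *m g = U *m g *m (g - b%:M).
    by rewrite -!mulmxA; congr (_ *m _); rewrite mulmxBl mulmxBr scalar_mxC.
  exact: submxMr.
exists b'; first by rewrite inE b's orbT.
apply: contraNneq n0' => E; rewrite -submx0 -E; exact: capmxS.
Qed.

(** * Common eigenvectors *)

Section CommonEigenvector.
Variables (n : nat) (G : 'M[rat]_n.+1 -> Prop).
Hypothesis Gmul : forall g h, G g -> G h -> G (g *m h).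
Hypothesis Gsplit : forall g, G g ->
  exists s : seq int, horner_mx g (\prod_(b <- s) ('X - b%:~R%:P)) = 0.

(** Induction on the rank: if some [g] is not scalar on [U], an eigenspace of [g] in [U] is smaller,
    and it is stable because the matrices commute on [U]. *)
Lemma common_eigenvector_sub (U : 'M[rat]_n.+1) :
    U != 0 -> (forall g, G g -> (U *m g <= U)%MS) ->
    (forall g h, G g -> G h -> U *m (g *m h - h *m g) = 0) ->
  exists2 v : 'rV[rat]_n.+1, v != 0 &
    forall g, G g -> exists c : int, v *m g = c%:~R *: v.
Proof.
have [k] := ubnP (\rank U); elim: k U => // k IHk U; rewrite ltnS => le_k U0 Ug Ucomm.
have [sc|] := pselect (forall g, G g -> exists c : int, U *m g = c%:~R *: U).
  have /rowV0Pn[v vU v0] := U0.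
  exists v => // g Gg; have [c E] := sc g Gg; exists c.
  by case/submxP: vU => w ->; rewrite -mulmxA E -scalemxAr.
move/existsNP => [g /not_implyP[Gg nsc]].
have [s sg] := Gsplit Gg.
have [|b /mapP[c _ ->] n0] :=
    @stable_eigenvector _ _ g U [seq b%:~R | b <- s] U0 (Ug g Gg).
  rewrite big_map -[RHS](mulmx0 _ U) -sg rmorph_prod; congr (_ *m _).
  by apply: eq_bigr => b _; rewrite rmorphB /= horner_mx_X horner_mx_C.
set U' := (U :&: _)%MS in n0.
have U'U : (U' <= U)%MS by apply: capmxSl.
have U'g : U' *m g = c%:~R *: U' by apply/eigenspaceP/capmxSr.
have U'comm h h' : G h -> G h' -> U' *m (h *m h' - h' *m h) = 0.
  by move=> Gh Gh'; have /submxP[X ->] := U'U; rewrite -mulmxA Ucomm ?mulmx0.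
apply: (IHk U') => //.
(* With equal ranks, [U] would lie in the eigenspace and [g] would be scalar on it. *)
- apply: leq_trans le_k; rewrite ltn_neqAle mxrankS // andbT.
  apply/eqP => E; apply: nsc; exists c; apply/eigenspaceP.
  by apply: submx_trans (capmxSr U _); rewrite -(mxrank_leqif_sup U'U).2 E.
- move=> h Gh; rewrite sub_capmx (submx_trans (submxMr h U'U) (Ug h Gh)) /=.
  apply/eigenspaceP; have /eqP := U'comm h g Gh Gg.
  by rewrite mulmxBr subr_eq0 !mulmxA => /eqP ->; rewrite U'g -scalemxAl.
Qed.

(** [U] is the largest subspace killed by all brackets. It contains [v], and it is stable because
    [G] is closed under products. *)
Lemma common_eigenvector_rat (v : 'rV[rat]_n.+1) :
    v != 0 -> (forall g h, G g -> G h -> v *m (g *m h - h *m g) = 0) ->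
  exists2 v : 'rV[rat]_n.+1, v != 0 &
    forall g, G g -> exists c : int, v *m g = c%:~R *: v.
Proof.
move=> v0 vcomm.
pose comm m (U : 'M[rat]_(m, n.+1)) :=
  forall g h, G g -> G h -> (U <= kermx (g *m h - h *m g))%MS.
pose P k := `[< exists2 U : 'M[rat]_n.+1, comm _ U & \rank U = k >].
have exP : exists k, P k.
  by exists 0%N; apply/asboolP; exists 0 => [g h _ _|]; rewrite ?sub0mx ?mxrank0.
have leP k : P k -> (k <= n.+1)%N by case/asboolP => U _ <-; apply: rank_leq_row.
case: (ex_maxnP exP leP) => k /asboolP[U Ucomm Uk] Umax.
have Usup m (W : 'M[rat]_(m, n.+1)) : comm m W -> (W <= U)%MS.
  move=> Wcomm; apply: (@submx_trans _ _ _ _ _ _ (U + W)%MS); first exact: addsmxSr.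
  have := (mxrank_leqif_sup (addsmxSl U W)).2 => <-.
  rewrite eqn_leq mxrankS ?addsmxSl //= Uk; apply: Umax; apply/asboolP.
  by exists (U + W)%MS => // g h Gg Gh; rewrite addsmx_sub Ucomm ?Wcomm.
apply: (@common_eigenvector_sub U).
- apply: contraNneq v0 => E; rewrite -submx0 -E; apply: Usup => g h Gg Gh.
  exact/sub_kermxP/vcomm.
- move=> u Gu; apply: Usup => g h Gg Gh; apply/sub_kermxP.
  have sw x y : G x -> G y -> U *m x *m y = U *m y *m x.
    move=> Gx Gy; have /sub_kermxP/eqP := Ucomm x y Gx Gy.
    by rewrite mulmxBr subr_eq0 !mulmxA => /eqP.
  apply/eqP; rewrite mulmxBr subr_eq0 !mulmxA; apply/eqP.
  (* [x] commutes on [U] with the product [y z], itself in [G]; then [y] and [z] can be exchanged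
     directly on [U]. *)
  have swM x y z : G x -> G y -> G z -> U *m x *m y *m z = U *m (y *m z) *m x.
    by move=> Gx Gy Gz; rewrite -mulmxA -sw //; apply: Gmul.
  by rewrite (swM u g h) // (swM u h g) // !mulmxA (sw g h).
- by move=> g h Gg Gh; apply/sub_kermxP/Ucomm.
Qed.
End CommonEigenvector.

Lemma rat_row_scale (r : nat) (v : 'rV[rat]_r) :
  exists2 w : 'rV[int]_r, (map_mx intr w == 0 :> 'rV[rat]_r) = (v == 0) &
    exists a : rat, map_mx intr w = a *: v.
Proof.
pose d := \prod_(j < r) denq (v 0 j).
have d0 : d%:~R != 0 :> rat.
  by rewrite intr_eq0; apply/prodf_neq0 => j _; apply: denq_neq0.
pose w := \row_j (numq (v 0 j) * \prod_(i < r | i != j) denq (v 0 i)).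
have wE : map_mx intr w = d%:~R *: v.
  apply/rowP => j; rewrite !mxE /d [in RHS](bigD1 j) //= !intrM numqE; ring.
exists w; last by exists d%:~R.
by rewrite wE scaler_eq0 (negPf d0).
Qed.

(** The vector killed by brackets is moved to the rationals, where Cayley-Hamilton and the split
    characteristic polynomials apply; denominators are cleared at the end. *)
Theorem common_eigenvector (r : nat) (G : 'M[int]_r -> Prop) :
    (0 < r)%N -> (forall g h, G g -> G h -> G (g *m h)) ->
    (forall p, prime p -> exists P : 'M['F_p]_r, triangularizes G P) ->
  exists2 v : 'rV[int]_r, v != 0 & forall g, G g -> exists c : int, v *m g = c *: v.
Proof.
case: r G => // n G _ Gmul trig.
have [v v0 vcomm] := exists_bracket_killed (ltn0Sn n) trig.
pose rat_mx r s (A : 'M[int]_(r, s)) : 'M[rat]_(r, s) := map_mx intr A.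
have rat_inj r s : injective (@rat_mx r s).
  move=> A B /matrixP E; apply/matrixP => i j.
  by have := E i j; rewrite !mxE => /intr_inj.
pose GQ (g : 'M[rat]_n.+1) := exists2 h, G h & g = rat_mx _ _ h.
have [||||w w0 wG] := @common_eigenvector_rat n GQ _ _ (rat_mx _ _ v).
- move=> _ _ [g Gg ->] [h Gh ->]; exists (g *m h); first exact: Gmul.
  by rewrite /rat_mx map_mxM.
- move=> _ [g Gg ->]; have [|s E] := @char_poly_splits n.+1 g.
    by move=> p p_pr; have [P [Pu tr]] := trig p p_pr; exists P => //; apply: tr.
  exists s; rewrite -[RHS](Cayley_Hamilton (rat_mx _ _ g)) -map_char_poly E.
  congr (horner_mx _ _); rewrite rmorph_prod /=; apply: eq_bigr => b _.
  by rewrite rmorphB /= map_polyX map_polyC.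
- by apply: contraNneq v0 => E; apply/eqP/rat_inj; rewrite E /rat_mx map_mx0.
- move=> _ _ [g Gg ->] [h Gh ->].
  by rewrite /rat_mx -!map_mxM -map_mxB -map_mxM vcomm ?map_mx0.
have [u u0 [a uE]] := rat_row_scale w.
exists u => [|g Gg].
  by apply: contraNneq w0 => E; rewrite -u0 E map_mx0.
have [|c cE] := wG (rat_mx _ _ g); first by exists g.
exists c; apply: rat_inj; rewrite /rat_mx map_mxM map_mxZ /= uE.
by rewrite -scalemxAl cE !scalerA mulrC.
Qed.

(** * Ideals contained in the socle *)

(** A type of its own, so that this abelian group becomes a [zmodType] with integer combinations. *)
Definition socle (B : brace) := {x : B | soc x}.

Section SocleZmod.
Variable B : brace.
Implicit Types (x y : socle B) (b : B).

HB.instance Definition _ := gen_eqMixin (socle B).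
HB.instance Definition _ := gen_choiceMixin (socle B).

Definition socle_add x y : socle B := exist _ _ (socD (svalP x) (svalP y)).
Definition socle_opp x : socle B := exist _ _ (socN (svalP x)).
Definition socle_zero : socle B := exist _ _ (soc0 B).

Lemma socle_addA : associative socle_add.
Proof. by move=> x y z; apply: eq_exist => /=; rewrite baddA. Qed.
Lemma socle_addC : commutative socle_add.
Proof. by move=> x y; apply: eq_exist => /=; rewrite (svalP x).2. Qed.
Lemma socle_add0 : left_id socle_zero socle_add.
Proof. by case=> x sx; apply: eq_exist => /=; rewrite badd0l. Qed.
Lemma socle_addN : left_inverse socle_zero socle_opp socle_add.
Proof. by move=> x; apply: eq_exist => /=; rewrite baddNl. Qed.

HB.instance Definition _ :=
  GRing.isZmodule.Build (socle B) socle_addA socle_addC socle_add0 socle_addN.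

Lemma svalD x y : sval (x + y) = badd (sval x) (sval y). Proof. by []. Qed.
Lemma svalN x : sval (- x) = bneg (sval x). Proof. by []. Qed.
Lemma sval0 : sval (0 : socle B) = bzero. Proof. by []. Qed.

Lemma sval_inj x y : sval x = sval y -> x = y.
Proof. by case: x y => x sx [y sy] /= E; apply: eq_exist. Qed.

Lemma svalMn x n : sval (x *+ n) = bmuln (sval x) n.
Proof. by elim: n => // n IHn; rewrite mulrS svalD IHn. Qed.

Lemma svalMz x z : sval (x *~ z) = bmulz (sval x) z.
Proof. by case: z => n; rewrite ?NegzE ?mulrNz ?svalN -pmulrn svalMn. Qed.

Definition socle_act b x : socle B := exist _ _ (soc_blam b (svalP x)).

Lemma socle_act_is_additive b : {morph socle_act b : x y / x - y}.
Proof. by move=> x y; apply: eq_exist => /=; rewrite blamD blamN. Qed.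
HB.instance Definition _ b :=
  GRing.isZmodMorphism.Build (socle B) (socle B) (socle_act b) (socle_act_is_additive b).

Lemma socle_actM a b x : socle_act (bmul a b) x = socle_act a (socle_act b x).
Proof. by apply: eq_exist => /=; rewrite blamM. Qed.
End SocleZmod.

Section Combination.
Variables (A : zmodType) (r : nat).
Implicit Types (e : 'I_r -> A) (a : 'rV[int]_r).

Definition combination e a : A := \sum_i e i *~ a 0 i.

Lemma combinationD e a b : combination e (a + b) = combination e a + combination e b.
Proof. by rewrite -big_split; apply: eq_bigr => i _; rewrite mxE mulrzDr. Qed.

Lemma combinationZ e c a : combination e (c *: a) = combination e a *~ c.
Proof.
rewrite /combination mulrz_suml; apply: eq_bigr => i _.
by rewrite mxE mulrC mulrzA.
Qed.

Lemma combination0 e : combination e 0 = 0.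
Proof. by rewrite -(scale0r 0) combinationZ mulr0z. Qed.

Lemma combinationN e a : combination e (- a) = - combination e a.
Proof. by rewrite -scaleN1r combinationZ mulrN1z. Qed.

Lemma combination_mul e s (M : 'M[int]_(s, r)) (b : 'rV[int]_s) :
  combination e (b *m M) = \sum_i combination e (row i M) *~ b 0 i.
Proof.
rewrite mulmx_sum_row (big_morph (combination e) (combinationD e) (combination0 e)).
by apply: eq_bigr => i _; rewrite combinationZ.
Qed.

Lemma combination_delta e i : combination e (delta_mx 0 i) = e i.
Proof.
rewrite /combination (bigD1 i) //= big1 ?addr0 => [|j ji].
  by rewrite mxE !eqxx mulr1z.
by rewrite mxE (negPf ji) andbF mulr0z.
Qed.
End Combination.

Definition spanned (B : brace) (J : B -> Prop) r (e : 'I_r -> socle B) :=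
  forall x, J x <-> exists a, x = sval (combination e a).

Section Spanned.
Variables (B : brace) (J : B -> Prop) (r : nat) (e : 'I_r -> socle B).
Hypotheses (idJ : ideal J) (Je : spanned J e).

Lemma spanned_mem a : J (sval (combination e a)).
Proof. by apply/Je; exists a. Qed.

Lemma spanned_gen i : J (sval (e i)).
Proof. by rewrite -combination_delta; apply: spanned_mem. Qed.

Lemma spanned_soc x : J x -> soc x.
Proof. by case/Je => a ->; apply: svalP. Qed.

Definition multiples n : B -> Prop := fun x => exists2 y, J y & x = bmuln y n.

Lemma multiples_sub n x : multiples n x -> J x.
Proof. by case=> y Jy ->; apply: ideal_bmuln. Qed.

Lemma multiplesP n x : multiples n x <-> exists a, x = sval (combination e (n%:Z *: a)).
Proof.
split=> [[y /Je[a ->] ->]|[a ->]]; last first.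
  exists (sval (combination e a)); first exact: spanned_mem.
  by rewrite combinationZ -pmulrn svalMn.
by exists a; rewrite combinationZ -pmulrn svalMn.
Qed.

Lemma multiples_ideal n : ideal (multiples n).
Proof.
apply: (@soc_subgroup_ideal B (@bzeroset B) J) => //.
- exact: bzeroset_ideal.
- exact/soc_quot0P/spanned_soc.
- by move=> _ ->; apply/multiplesP; exists 0; rewrite scaler0 combination0.
- exact: multiples_sub.
- split; first by apply/multiplesP; exists 0; rewrite scaler0 combination0.
  split=> [x y /multiplesP[a ->] /multiplesP[b ->]|x /multiplesP[a ->]]; apply/multiplesP.
    by exists (a + b); rewrite scalerDr combinationD svalD.
  by exists (- a); rewrite scalerN combinationN svalN.
move=> b _ [y Jy ->]; exists (blam b y); first exact: ideal_blam.
by rewrite blam_bmuln.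
Qed.

Lemma multiples_finite n : (0 < n)%N -> finite_quot (multiples n) J.
Proof.
move=> n_gt0.
pose h (u : {ffun 'I_r -> 'I_n}) := combination e (\row_i (u i)%:Z).
apply: (@finite_quotI _ _ (fun u => sval (h u))); first by move=> u; apply: spanned_mem.
move=> x /Je[a ->].
have lt_mod i : (`|(a ord0 i %% n)%Z|%N < n)%N.
  by rewrite -ltz_nat gez0_abs ?modz_ge0 ?ltz_pmod // -lt0n.
exists [ffun i => Ordinal (lt_mod i)]; apply/multiplesP.
exists (\row_i (a ord0 i %/ n)%Z); rewrite /cong -svalN -svalD /h -combinationN -combinationD.
congr (sval _); apply: congr1; apply/rowP => i; rewrite !mxE ffunE /=.
rewrite gez0_abs ?modz_ge0 -?lt0n //.
by rewrite {2}(divz_eq (a ord0 i) n); ring.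
Qed.
End Spanned.

(* A nontrivial relation between [r + 1] generators becomes, after a unimodular
   change of generators, [n e'_0 = 0]; hence [n J] has [r] generators, and [J / n J]
   is finite. *)
Lemma relation_change_basis (A : zmodType) r (e : 'I_r.+1 -> A) (a : 'rV[int]_r.+1) :
    a != 0 -> combination e a = 0 ->
  exists (e' : 'I_r.+1 -> A) (n : nat), [/\ (0 < n)%N, e' ord0 *+ n = 0 &
    forall x, (exists b, x = combination e b) <-> (exists b, x = combination e' b)].
Proof.
(* Smith form of a single row: [L] has size one, so [a] is an integer multiple of the first row of
   the unimodular [R]. *)
move=> a0 ea; have [L L_unit [R R_unit [d _ aE]]] := int_Smith_normal_form a.
pose e' i := combination e (row i R).
have e'E b : combination e' b = combination e (b *m R) by rewrite combination_mul.
have aE' : a = (L 0 0 * d`_0) *: row ord0 R.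
  rewrite aE -mulmxA; apply/rowP => j; rewrite mxE big_ord_recl big_ord0 addr0.
  rewrite !mxE (bigD1 ord0) //= big1 ?addr0 => [|k k0].
    by rewrite !mxE eqxx mulr1n mulrA.
  rewrite !mxE (_ : (0 == k :> nat) = false) ?mulr0n ?mul0r //.
  by apply/negbTE; rewrite eq_sym; apply: contraNneq k0 => k0; apply/eqP/val_inj.
pose c := L 0 0 * d`_0; have c0 : c != 0.
  by apply: contraNneq a0 => c0; rewrite aE' -/c c0 scale0r.
exists e', `|c|%N; split; first by rewrite absz_gt0.
  have : e' ord0 *~ c = 0 by rewrite -combinationZ -aE'.
  case: (c) => k; first by rewrite -pmulrn.
  by rewrite NegzE mulrNz -pmulrn abszN => /eqP; rewrite oppr_eq0 => /eqP.
move=> x; split=> [[b ->]|[b ->]]; last by exists (b *m R); rewrite e'E.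
by exists (b *m invmx R); rewrite e'E mulmxKV.
Qed.

Lemma combination_lift0 (A : zmodType) r (e : 'I_r.+1 -> A) n (b : 'rV[int]_r.+1) :
  e ord0 *+ n = 0 ->
  combination e b *+ n =
  combination (fun i => e (lift ord0 i) *+ n) (\row_i b ord0 (lift ord0 i)).
Proof.
move=> en; rewrite /combination -sumrMnl big_ord_recl.
have -> : e ord0 *~ b ord0 ord0 *+ n = 0.
  by rewrite !pmulrn -mulrzA mulrC mulrzA -pmulrn en mul0rz.
rewrite add0r; apply: eq_bigr => i _.
by rewrite mxE !pmulrn -!mulrzA mulrC.
Qed.

(** Quantified over all braces, since the induction on [r] passes to quotients of [B] and to smaller
    ideals. *)
Definition socle_case r := forall (B : brace) (J : B -> Prop) (e : 'I_r -> socle B),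
  finite_images_supersoluble B -> ideal J -> spanned J e ->
  supersoluble_quot J -> supersoluble B.

(** [J / n J] is finite, so supersolubility descends from [B / J] to [B / n J]; and [n J] has only
    [r] generators, to which the induction hypothesis applies. *)
Lemma socle_case_relation r (B : brace) (J : B -> Prop) (e : 'I_r.+1 -> socle B) a :
    socle_case r -> a != 0 -> combination e a = 0 ->
    finite_images_supersoluble B -> ideal J -> spanned J e ->
  supersoluble_quot J -> supersoluble B.
Proof.
move=> IH a0 ea good idJ Je ssJ.
have [e' [n [n_gt0 en e'P]]] := relation_change_basis a0 ea.
have Je' : spanned J e'.
  move=> x; rewrite Je; split=> [[b ->]|[b ->]].
    by have [c ->] := (e'P (combination e b)).1 (ex_intro _ b erefl); exists c.
  by have [c ->] := (e'P (combination e' b)).2 (ex_intro _ b erefl); exists c.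
have idD := multiples_ideal idJ Je' n.
have ssD : supersoluble_quot (multiples J n).
  apply: (finite_images_supersoluble_finite good idD idJ _ _ ssJ).
    exact: multiples_sub.
  exact: multiples_finite Je' n n_gt0.
apply: (IH B (multiples J n) (fun i => e' (lift ord0 i) *+ n)) => // x.
rewrite (multiplesP Je'); split=> [[b ->]|[b ->]].
  rewrite combinationZ -pmulrn combination_lift0 //.
  by eexists.
(* The coordinate on [e' ord0] is set to [0], as [n] kills that generator. *)
exists (\row_i (if unlift ord0 i is Some j then b ord0 j else 0)).
rewrite combinationZ -pmulrn combination_lift0 //; congr (sval _); apply: congr1.
by apply/rowP => i; rewrite !mxE liftK.
Qed.

(** * Free ideals in the socle: flags modulo [p] and cyclic ideals *)

Section FreeSocle.
Variables (B : brace) (J : B -> Prop) (r : nat) (e : 'I_r -> socle B).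
Hypotheses (idJ : ideal J) (Je : spanned J e).
Hypothesis e_free : forall a, combination e a = 0 -> a = 0.
Local Notation phi := (combination e).

Lemma combination_inj a b : phi a = phi b -> a = b.
Proof.
move=> E; apply/eqP; rewrite -subr_eq0; apply/eqP/e_free.
by rewrite combinationD combinationN E subrr.
Qed.

Definition acts_as (b : B) (M : 'M[int]_r) := forall a, socle_act b (phi a) = phi (a *m M).

Lemma acts_as_exists b : exists M, acts_as b M.
Proof.
have h i : exists a, socle_act b (e i) = phi a.
  have /Je[a E] : J (blam b (sval (e i))) by apply: ideal_blam => //; apply: (spanned_gen Je).
  by exists a; apply: sval_inj.
exists (\matrix_i sval (cid (h i))) => a.
rewrite combination_mul /combination raddf_sum; apply: eq_bigr => i _ /=.
by rewrite rowK raddfMz; case: (cid (h i)) => c /= ->.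
Qed.

Definition action_mx (M : 'M[int]_r) := exists b, acts_as b M.

Lemma action_mx_mul M N : action_mx M -> action_mx N -> action_mx (M *m N).
Proof.
(* Matrices act on row vectors from the right, so the order is reversed. *)
move=> [b bM] [c cN]; exists (bmul c b) => a.
by rewrite socle_actM bM cN mulmxA.
Qed.

Section Flag.
Variable p : nat.
Hypothesis p_pr : prime p.
Local Notation red a := (map_mx intr a : 'rV['F_p]_r).

Lemma red_eq0 a : red a = 0 -> exists b, a = p%:Z *: b.
Proof.
move=> a0; exists (\row_j (a ord0 j %/ p)%Z); apply/rowP => j; rewrite !mxE.
rewrite mulrC divzK //.
by have /rowP/(_ j) := a0; rewrite !mxE (dvdz_Fp p_pr) => ->.
Qed.

Lemma red_surj w : exists a, red a = w.
Proof.
exists (\row_j (Posz (val (w ord0 j)))); apply/rowP => j; rewrite !mxE.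
by rewrite -pmulrn natr_Zp.
Qed.

(** Describes [K] by its row space in [J / p J]. The rows of [X] form a basis adapted to the ideals
    below, in which all action matrices are lower triangular. *)
Definition flag_member s (X : 'M['F_p]_(s, r)) (K : B -> Prop) :=
  [/\ row_free X,
      forall a, K (sval (phi a)) <-> (red a <= X)%MS &
      forall g, action_mx g ->
        exists2 L : 'M_s, is_trig_mx L & X *m map_mx intr g = L *m X].

Lemma flag_bottom : flag_member (0 : 'M_(0, r)) (multiples J p).
Proof.
split=> [|a|g _]; first by rewrite /row_free mxrank0.
- rewrite (multiplesP Je).
  split=> [[b E]|]; first rewrite (combination_inj (sval_inj E)).
    rewrite map_mxZ /= -[X in X *: _]pmulrn pchar_Fp_0 // scale0r.
    exact: sub0mx.
  by move=> /submx0null/red_eq0[b ->]; exists b.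
by exists 0; rewrite ?mx0_is_trig // !mul0mx.
Qed.

(** The reduction of an element of [K'] outside [K] is appended as last row. It generates [K']
    modulo [K], so the new row space is that of [K'], and invariance of [K'] gives the new last row
    of each triangular matrix. *)
Lemma flag_step s (X : 'M_(s, r)) (K K' : B -> Prop) :
    ideal K -> ideal K' -> (forall x, K x -> K' x) -> (forall x, K' x -> J x) ->
    prime_order_quot K K' -> flag_member X K ->
  exists X' : 'M_(s + 1, r), flag_member X' K'.
Proof.
move=> idK idK' KK' K'J pKK' [X_free XK Xg].
have [x0 Kx0 K'x0] : exists2 x, K' x & ~ K x.
  have [q [f [q_pr K'f f_inj _]]] := pKK'.
  apply: contrapT => no; have all_K x : K' x -> K x.
    by move=> K'x; apply: contrapT => Kx; apply: no; exists x.
  have /f_inj : cong K (f 0%N) (f 1%N).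
    apply: idealD; rewrite ?prime_gt0 ?prime_gt1 //; [apply: idealN => //|];
      by apply/all_K/K'f; rewrite ?prime_gt0 ?prime_gt1.
  by rewrite prime_gt0 ?prime_gt1 // => /(_ isT isT).
have [a0 x0E] := (Je x0).1 (K'J _ Kx0); subst x0.
have gen a : K' (sval (phi a)) -> exists n, (red (a - n%:Z *: a0)%R <= X)%MS.
  move=> K'a; have [n hn] := prime_order_generator idK idK' KK' pKK' Kx0 K'x0 K'a.
  exists n; apply/XK; rewrite addrC combinationD combinationN combinationZ -pmulrn.
  by rewrite svalD svalN svalMn.
have x0X : ~~ (red a0 <= X)%MS by apply/negP => /XK.
have sub a : K' (sval (phi a)) <-> (red a <= col_mx X (red a0))%MS.
  split=> [/gen[n]|].
    rewrite map_mxB map_mxZ /= => h.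
    rewrite -[red a](subrK (n%:~R *: red a0)) addmx_sub //.
      by apply: submx_trans h _; rewrite -addsmxE addsmxSl.
    by rewrite scalemx_sub // -addsmxE addsmxSr.
  rewrite -addsmxE => /sub_addsmxP[[u w] /= E].
  have [c cE] := red_surj (u *m X) .
  have Kc : K (sval (phi c)) by apply/XK; rewrite cE submxMl.
  have [d dE] : exists d : int, d%:~R = w 0 0 :> 'F_p by apply: Fp_lift.
  (* Lifting the relation to the integers costs a multiple of [p], which lies in [K] because its
     reduction is zero. *)
  have [b ab] : exists b, a = c + d *: a0 + p%:Z *: b.
    have [|b bE] := @red_eq0 (a - (c + d *: a0)); last by exists b; rewrite -bE addrC subrK.
    have wE : w *m red a0 = w 0 0 *: red a0 by rewrite {1}[w]mx11_scalar mul_scalar_mx.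
    by rewrite map_mxB map_mxD map_mxZ /= cE E dE wE subrr.
  have Kp : K (sval (phi (p%:Z *: b))).
    apply/XK; rewrite map_mxZ /= -[X in X *: _]pmulrn pchar_Fp_0 // scale0r; exact: sub0mx.
  rewrite ab !combinationD !svalD; apply: idealD => //; last exact: KK'.
  apply: idealD => //; first exact: KK'.
  by rewrite combinationZ svalMz; apply: ideal_bmulz.
exists (col_mx X (red a0)); split=> //.
- apply: inj_row_free => v; rewrite -[v]hsubmxK mul_row_col.
  set u := lsubmx v; set w := rsubmx v => E.
  have wE : w *m red a0 = w 0 0 *: red a0 by rewrite {1}[w]mx11_scalar mul_scalar_mx.
  have w0 : w 0 0 = 0.
    apply: contraNeq x0X => w0.
    have -> : red a0 = (w 0 0)^-1 *: (w *m red a0) by rewrite wE scalerK.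
    move/eqP: E; rewrite addrC addr_eq0 => /eqP ->.
    by rewrite scalemx_sub // eqmx_opp submxMl.
  have w_eq0 : w = 0 by rewrite [w]mx11_scalar w0 raddf0.
  move: E; rewrite w_eq0 mul0mx addr0 => E.
  have -> : u = 0 by apply: (row_free_inj X_free); rewrite E mul0mx.
  by rewrite row_mx0.
move=> g Gg; have [L Ltrig LE] := Xg g Gg.
have [b bg] := Gg.
have : (red (a0 *m g) <= col_mx X (red a0))%MS.
  by apply/sub; rewrite -bg; apply: ideal_blam.
rewrite -addsmxE => /sub_addsmxP[[u w] /= E].
exists (block_mx L 0 u w).
  by rewrite is_trig_block_mx // eqxx Ltrig mx11_is_trig.
by rewrite mul_col_mx mul_block_col LE mul0mx addr0 -E map_mxM.
Qed.

Lemma flag_chain (K K' : B -> Prop) s (X : 'M_(s, r)) :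
    chain (@prime_order_quot B) K K' -> (forall x, K' x -> J x) -> flag_member X K ->
  exists s' (X' : 'M_(s', r)), flag_member X' K'.
Proof.
move=> ch; elim: ch s X => [L idL|K0 L M idK KL pKL ch IH] s X sub XK; first by exists s, X.
have LM := chain_sub ch.
have [X' X'L] := flag_step idK (chain_ideall ch) KL (fun x Lx => sub x (LM x Lx)) pKL XK.
exact: IH X'L.
Qed.

(** The flag ends with the whole space, so its matrix [X] is square and invertible. *)
Lemma flag_triangularizes :
  chain (@prime_order_quot B) (multiples J p) J ->
  exists P : 'M['F_p]_r, triangularizes action_mx P.
Proof.
move=> ch; have [s [X [X_free XJ Xg]]] := flag_chain ch (fun x Jx => Jx) flag_bottom.
have X_full : row_full X.
  rewrite -sub1mx; apply/row_subP => i.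
  have [a <-] := red_surj (row i 1%:M); apply/XJ; exact: spanned_mem.
  have sr : s = r by rewrite -(eqP X_full); apply/esym/eqP.
subst s; exists X; split=> [|g /Xg[L Ltrig ->]]; first by rewrite -row_free_unit.
by rewrite mulmxK // -row_free_unit.
Qed.
End Flag.

(** A common eigenvector of the action matrices spans an ideal, which is infinite by freeness. *)
Lemma free_socle_cyclic_ideal :
    (0 < r)%N ->
    (forall p, prime p -> chain (@prime_order_quot B) (multiples J p) J) ->
  exists v, let w := sval (phi v) in [/\ v != 0, ideal (socspan w),
    forall x, socspan w x -> J x & infcyclic_quot (@bzeroset B) (socspan w)].
Proof.
move=> r_gt0 ch.
have [|v v0 vP] := common_eigenvector r_gt0 action_mx_mul.
  by move=> p p_pr; apply: flag_triangularizes => //; apply: ch.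
exists v => w; have sw : soc w by apply: svalP.
have Jw : J w by apply: spanned_mem.
split=> //.
- apply: socspan_ideal => // b.
  have [M bM] := acts_as_exists b.
  have [c cE] : exists c : int, v *m M = c *: v by apply: vP; exists b.
  have -> : blam b w = bmulz w c by rewrite -svalMz -combinationZ -cE -bM.
  exact: socspan_bmulz.
- by move=> _ [i [j ->]]; apply: idealD => //; [|apply: idealN => //]; apply: ideal_bmuln.
exists w; split=> [|x [i [j ->]]|n n_gt0]; first exact: socspan_self.
  exists (i%:Z - j%:Z); apply/cong_bzeroset.
  by rewrite -svalMz mulrzBr svalD svalN -!pmulrn !svalMn.
rewrite /bzeroset -svalMn pmulrn -combinationZ -sval0 => /sval_inj/e_free/eqP.
by rewrite scalemx_eq0 (negPf v0) orbF -[_ == _]/(n == 0)%N => /eqP n0; rewrite n0 in n_gt0.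
Qed.
End FreeSocle.

(** * Socle elements in quotients and induction on the number of generators *)

Section SocleMap.
Variables (B Q : brace) (I : B -> Prop) (f : B -> Q).
Hypothesis fq : quotient_map I f.

Lemma qm_soc x : soc x -> soc (f x).
Proof.
move=> [lam1 cen]; split=> q; have [b <-] := qm_surj fq q.
  by rewrite -(qm_blam fq) lam1.
by rewrite -!(qmD fq) cen.
Qed.

Definition socle_map (x : socle B) : socle Q := exist _ _ (qm_soc (svalP x)).

Lemma socle_map_is_additive : {morph socle_map : x y / x - y}.
Proof. by move=> x y; apply: sval_inj; rewrite svalD svalN /= (qmD fq) (qmN fq). Qed.

Lemma socle_map_combination r (e : 'I_r -> socle B) a :
  sval (combination (fun i => socle_map (e i)) a) = f (sval (combination e a)).
Proof.
pose h : {additive socle B -> socle Q} :=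
  HB.pack socle_map (GRing.isZmodMorphism.Build _ _ socle_map socle_map_is_additive).
rewrite -[RHS]/(sval (h (combination e a))) /combination raddf_sum.
by congr (sval _); apply: eq_bigr => i _; rewrite raddfMz.
Qed.
End SocleMap.

Lemma spanned_quotient (B Q : brace) (I J : B -> Prop) (f : B -> Q)
    (fq : quotient_map I f) r (e : 'I_r -> socle B) :
  spanned J e -> spanned (image f J) (fun i => socle_map fq (e i)).
Proof.
move=> Je q; split=> [[x /Je[a ->] <-]|[a ->]].
  by exists a; rewrite socle_map_combination.
by rewrite socle_map_combination; exists (sval (combination e a)) => //; apply: spanned_mem.
Qed.

Lemma supersoluble_of_quotient (B Q : brace) (I : B -> Prop) (f : B -> Q) :
  quotient_map I f -> supersoluble Q -> supersoluble_quot I.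
Proof.
move=> fq; rewrite -(preim_zero fq) (supersoluble_quot_preim fq) //.
exact: bzeroset_ideal.
Qed.

Lemma supersoluble_quot_image (B Q : brace) (I J : B -> Prop) (f : B -> Q) :
    quotient_map I f -> ideal J -> (forall x, I x -> J x) ->
  supersoluble_quot J -> supersoluble_quot (image f J).
Proof.
move=> fq idJ IJ; have := supersoluble_quot_preim fq (ideal_image fq idJ).
by rewrite (preim_image fq idJ IJ) => -[].
Qed.

Theorem socle_caseP r : socle_case r.
Proof.
elim: r => [|r IHr] B J e good idJ Je ssJ.
  suff J0 : J = @bzeroset B by rewrite /supersoluble -J0.
  apply: set_ext => x; split=> [/Je[a ->]|->]; last exact: ideal0.
  by rewrite /combination big_ord0.
have [[a [a0 ea]]|no] := pselect (exists a, a != 0 /\ combination e a = 0).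
  exact: (socle_case_relation IHr a0 ea good idJ Je ssJ).
have e_free a : combination e a = 0 -> a = 0.
  by move=> ea; apply: contrapT => /eqP a0; apply: no; exists a.
have flags p : prime p -> chain (@prime_order_quot B) (multiples J p) J.
  move=> p_pr; apply: finite_images_prime_chain => //.
  - exact: (multiples_ideal idJ Je).
  - exact: multiples_sub.
  - by apply: (multiples_finite Je); apply: prime_gt0.
  - exact/supersoluble_quotP.
have [v [v0 idC CJ cycC]] := free_socle_cyclic_ideal idJ Je e_free (ltn0Sn r) flags.
set C := socspan _ in idC CJ cycC.
have [Q [f fq]] := exists_quotient idC.
have ssC : supersoluble_quot C.
  apply: (supersoluble_of_quotient fq).
  (* In [B / C] the images of the [r + 1] generators satisfy the nontrivial relation [v], so the
     dependent case applies. *)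
  apply: (@socle_case_relation r Q (image f J) (fun i => socle_map fq (e i)) v) => //.
  - apply: sval_inj; rewrite socle_map_combination; apply/(qm_ker fq).
    exact: socspan_self.
  - exact: finite_images_supersoluble_quotient fq good.
  - exact: (ideal_image fq idJ).
  - exact: spanned_quotient.
  - exact: supersoluble_quot_image fq idJ CJ ssJ.
apply/supersoluble_quotP; apply: chain_step (iffLR (supersoluble_quotP C) ssC).
- exact: bzeroset_ideal.
- by move=> _ ->; apply: ideal0.
left; split=> //; apply/soc_quot0P => x /CJ; exact: spanned_soc Je x.
Qed.

(** In [B / I] the generators of [J] as a brace also generate it additively, since products and
    inverses in the socle are sums and opposites. *)
Lemma supersoluble_quot_socle (B : brace) (I J : B -> Prop) :
    finite_images_supersoluble B -> ideal I -> ideal J -> (forall x, I x -> J x) ->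
    soc_quot I J -> fg_quot I J -> supersoluble_quot J ->
  supersoluble_quot I.
Proof.
move=> good idI idJ IJ sIJ [n [g [Jg genJ]]] ssJ.
have [Q [f fq]] := exists_quotient idI.
have idfJ := ideal_image fq idJ.
have fJ_soc q : image f J q -> soc q.
  move: q; apply/soc_quot0P/(soc_quot_preim fq).
  by rewrite (preim_zero fq) (preim_image fq idJ IJ).
have fg_soc (i : 'I_n) : soc (f (g i)).
  by apply: fJ_soc; exists (g i) => //; apply: Jg.
pose e i : socle Q := exist _ _ (fg_soc i).
apply: (supersoluble_of_quotient fq).
apply: (@socle_caseP n Q (image f J) e) => //; last first.
- exact: supersoluble_quot_image fq idJ IJ ssJ.
- move=> q; split=> [[x Jx <-]|[a ->]]; last first.
    rewrite -[image f J _]/((fun x : socle Q => image f J (sval x)) _).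
    rewrite /combination; elim/big_rec: _ => [|i x _ Jx]; first exact: ideal0.
    rewrite svalD svalMz; apply: idealD => //; apply: ideal_bmulz => //.
    by exists (g i) => //; apply: Jg.
  (* The preimage of the integer combinations is a subbrace containing [I] and the generators, hence
     contains [J]. *)
  apply: ((genJ x).1 Jx (fun y => exists a, f y = sval (combination e a))).
    split; split.
    + by exists 0; rewrite combination0 (qm0 fq).
    + split=> [y z [a ya] [b zb]|y [a ya]].
        by exists (a + b); rewrite combinationD (qmD fq) ya zb.
      by exists (- a); rewrite combinationN (qmN fq) ya.
    + by exists 0; rewrite combination0 bone0 (qm0 fq).
    split=> [y z [a ya] [b zb]|y [a ya]].
      exists (a + b); rewrite combinationD (qmM fq) ya zb soc_mulE //.
      exact: svalP.
    exists (- a); rewrite combinationN (qmV fq) ya soc_binvE //.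
    exact: svalP.
  move=> y [Iy|[i lt_i ->]].
    by exists 0; rewrite combination0; apply/(qm_ker fq).
  by exists (delta_mx 0 (Ordinal lt_i)); rewrite combination_delta.
- exact: finite_images_supersoluble_quotient fq good.
Qed.

Theorem theorem3p51 (B : brace) :
  almost_polycyclic B ->
  (supersoluble B <->
   forall I : B -> Prop, ideal I -> finite_quot I (@bfull B) -> supersoluble_quot I).
Proof.
move=> /ideal_chainP ap; split=> [ss I|good]; first exact: supersoluble_finite_image.
rewrite /supersoluble; move E: (@bfull B) ap => T ap.
(* Supersolubility is carried down the chain, from the trivial quotient at the top to [B] itself. *)
elim: ap E => [I idI <-|I J K idI IJ st ch IH E].
  exact/supersoluble_quotP/chain_refl.
have idJ := chain_ideall ch.
case: st => [[sIJ fgIJ]|fin]; first exact: supersoluble_quot_socle (IH E).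
exact: finite_images_supersoluble_finite (IH E).
Qed.
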